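(* In the Grothendieck group $G_0(kG^F)$ of finitely generated $kG^F$-modules one has $$d([\Gamma_1]_K)=d([\Gamma_2]_K)=2\sum_{i=1}^{q-2}[V_i]_k+[V_0]_k+[V_{q-1}]_k.$$
   Context: Let $q$ be a power of a prime $p$, let $G=\mathrm{SL}_2$ over $\mathbb{F}_q$ with geometric Frobenius endomorphism $F$, so that $G^F=\mathrm{SL}_2(\mathbb{F}_q)$. Let $K$ be a finite extension of $\mathrm{Frac}(W(\mathbb{F}_q))$ (where $W(\mathbb{F}_q)$ is the ring of Witt vectors over $\mathbb{F}_q$) such that every complex irreducible representation of $G^F$ is realisable over $K$, and let $k$ be the residue field of $K$. For $A\in\{K,k\}$ and a finitely generated $AG^F$-module $M$, $[M]_A$ denotes its class in the Grothendieck group $G_0(AG^F)$ of finitely generated $AG^F$-modules. The map $d\colon G_0(KG^F)\to G_0(kG^F)$ is the decomposition map (choose a $G^F$-stable lattice over the valuation ring of $K$ and reduce it modulo the maximal ideal). Put $V_i:=\mathrm{Sym}^i(k^2)$, with $k^2$ the natural representation of $G^F\subseteq\mathrm{GL}_2(k)$. Let $B$ be the subgroup of upper-triangular matrices of $G$, $U$ its unipotent radical, and $S$ the diagonal subgroup of $G$, acting on $U$ by conjugation. If $q$ is odd, the non-trivial irreducible characters of $U^F$ form two $S^F$-orbits, and $\psi_1,\psi_2$ denote chosen representatives of these two orbits. If $q$ is even there is only one such orbit, and $\psi_1=\psi_2$ denotes a chosen representative of it. The Gelfand--Graev representations of $G^F$ are $\Gamma_i:=\mathrm{Ind}_{U^F}^{G^F}\psi_i$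 ($i=1,2$); they do not depend on the choice of representatives, and are regarded as representations over $K$. *)

(* Defs.v *)
From HB Require Import structures.
From mathcomp Require Import all_boot all_order all_algebra all_fingroup.
From mathcomp Require Import all_solvable all_field all_character.
From mathcomp Require Import boolp classical_sets.
From mathcomp Require Import freeg.

Set Implicit Arguments.
Unset Strict Implicit.
Unset Printing Implicit Defensive.

Import GRing.Theory.
Local Open Scope ring_scope.
Local Open Scope quotient_scope.

(* Finitely generated AG-modules, A a field: the matrix representations of
   every (possibly zero) dimension, acting on row vectors. *)
Definition fgmod (A : fieldType) (gT : finGroupType) (G : {group gT}) : Type :=
  {n : nat & mx_representation A G n}.

HB.instance Definition _ (A : fieldType) (gT : finGroupType) (G : {group gT}) :=
  gen_eqMixin (fgmod A G).
HB.instance Definition _ (A : fieldType) (gT : finGroupType) (G : {group gT}) :=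
  gen_choiceMixin (fgmod A G).

Definition to_fgmod (A : fieldType) (gT : finGroupType) (G : {group gT})
    (n : nat) (M : mx_representation A G n) : fgmod A G :=
  existT (fun n => mx_representation A G n) n M.

(* 0 -> M1 -f-> M -g-> M2 -> 0; matrices act on the right of row vectors. *)
Definition short_exact (A : fieldType) (gT : finGroupType) (G : {group gT})
    (M1 M M2 : fgmod A G) : Prop :=
  exists (f : 'M[A]_(tag M1, tag M)) (g : 'M[A]_(tag M, tag M2)),
    [/\ {in G, forall x, tagged M1 x *m f = f *m tagged M x},
        {in G, forall x, tagged M x *m g = g *m tagged M2 x},
        row_free f, (f == kermx g)%MS & row_full g].

Section GrothendieckGroup.
Variables (A : fieldType) (gT : finGroupType) (G : {group gT}).

Inductive ses_relation : {freeg (fgmod A G)} -> Prop :=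
| ses_relation0 : ses_relation 0
| ses_relation_ses M1 M M2 : short_exact M1 M M2 ->
    ses_relation (<< M >> - << M1 >> - << M2 >>)
| ses_relationB u v : ses_relation u -> ses_relation v -> ses_relation (u - v).

Definition ses_subgroup : {pred {freeg (fgmod A G)}} :=
  fun u => `[< ses_relation u >].

Lemma ses_subgroup_zmod : zmod_closed ses_subgroup.
Proof.
split; first by apply/asboolP; exact: ses_relation0.
by move=> u v /asboolP ru /asboolP rv; apply/asboolP; exact: ses_relationB.
Qed.

HB.instance Definition _ :=
  GRing.isZmodClosed.Build {freeg (fgmod A G)} ses_subgroup ses_subgroup_zmod.

Definition G0 : zmodType := Quotient.quot ses_subgroup.

Definition G0_class (n : nat) (M : mx_representation A G n) : G0 :=
  \pi_(Quotient.quot ses_subgroup) << to_fgmod M >>.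

End GrothendieckGroup.

(* W is the ring of Witt vectors over the finite field F of characteristic p,
   with residue map r: the strict p-ring with residue field F, i.e. p is not a
   zero divisor, W is complete and separated for the p-adic topology and r
   induces W/pW = F.  These properties determine (W, r) up to a unique
   isomorphism (Serre, Local Fields, II.5-6). *)
Definition Witt_ring (p : nat) (F : finFieldType) (W : idomainType)
    (r : {rmorphism W -> F}) : Prop :=
  let cong (n : nat) (u v : W) := exists w : W, u - v = p%:R ^+ n * w in
  [/\ (p%:R : W) != 0,
      (forall a : F, exists w : W, r w = a),
      (forall w : W, r w = 0 <-> cong 1%N w 0),
      (forall w : W, (forall n, cong n w 0) -> w = 0) &
      (forall u : nat -> W, (forall n, cong n (u n.+1) (u n)) ->
         exists l : W, forall n, cong n l (u n))].

(* O, embedded in K by iO, is the valuation ring of the valuation on K that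
   extends the one of W: the image of O is a valuation subring of K that
   contains W and dominates it. *)
Definition valuation_ring (W : idomainType) (K : fieldExtType {fraction W})
    (O : idomainType) (jO : {rmorphism W -> O}) (iO : {rmorphism O -> K}) :
    Prop :=
  [/\ injective iO,
      (forall x : K, exists a : O, x = iO a \/ x^-1 = iO a),
      (forall w : W, iO (jO w) = in_alg K (tofrac w)) &
      (forall w : W, jO w \is a GRing.unit -> w \is a GRing.unit)].

Definition residue_field (O : idomainType) (k : fieldType)
    (res : {rmorphism O -> k}) : Prop :=
  (forall a : k, exists x : O, res x = a) /\
  (forall x : O, (res x == 0) = (x \isn't a GRing.unit)).

(* An OG-lattice, O a valuation ring, is free over O, hence a matrix
   representation over O.  When O is the valuation ring of K and k its residue
   field, the element y below exists for every x and does not depend on the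
   choice of the lattices (Brauer-Nesbitt). *)
Definition decomposition (K : fieldType) (O : idomainType) (k : fieldType)
    (iO : {rmorphism O -> K}) (res : {rmorphism O -> k})
    (gT : finGroupType) (G : {group gT}) (x : G0 K G) : G0 k G :=
  xget 0 [set y | exists (n1 n2 : nat) (L1 : mx_representation O G n1)
                         (L2 : mx_representation O G n2),
    x = G0_class (map_repr iO L1) - G0_class (map_repr iO L2) /\
    y = G0_class (map_repr res L1) - G0_class (map_repr res L2)].

Section SL2.
Variable F : finFieldType.
Implicit Type g : {'GL_2[F]}.

Definition GL2_mx g : 'M[F]_2 := GLval g.

Lemma GL2_mx1 : GL2_mx 1 = 1%:M. Proof. by []. Qed.

Lemma GL2_mxM g h : GL2_mx (g * h)%g = GL2_mx g *m GL2_mx h.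
Proof. by []. Qed.

Definition SL2_set : {set {'GL_2[F]}} := [set g | \det (GL2_mx g) == 1].

Lemma SL2_group_set : group_set SL2_set.
Proof.
apply/group_setP; split; first by rewrite inE GL2_mx1 det1.
by move=> g h; rewrite !inE GL2_mxM det_mulmx => /eqP-> /eqP->; rewrite mulr1.
Qed.
Canonical SL2_group := Group SL2_group_set.

Definition SL2_unip_set : {set {'GL_2[F]}} :=
  [set g | [&& GL2_mx g 0 0 == 1, GL2_mx g 1 0 == 0 & GL2_mx g 1 1 == 1]].

Lemma SL2_unip_group_set : group_set SL2_unip_set.
Proof.
apply/group_setP; split; first by rewrite inE GL2_mx1 !mxE /= !eqxx.
move=> g h; rewrite !inE GL2_mxM => /and3P[/eqP g0 /eqP g1 /eqP g2].
move=> /and3P[/eqP h0 /eqP h1 /eqP h2].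
rewrite !mxE !big_ord_recl !big_ord0 /=.
have -> : fintype.lift ord0 ord0 = 1 :> 'I_2 by exact/val_inj.
have -> : ord0 = 0 :> 'I_2 by [].
by rewrite g0 g1 g2 h0 h1 h2 !mulr0 !mul0r !mulr1 !addr0 add0r !eqxx.
Qed.
Canonical SL2_unip := Group SL2_unip_group_set.

Definition SL2_torus : {set {'GL_2[F]}} :=
  [set g in SL2_group | (GL2_mx g 0 1 == 0) && (GL2_mx g 1 0 == 0)].

End SL2.

(* i1 and i2 index representatives of the torus orbits on the non-trivial
   irreducible characters of U; 'chi_0 is the trivial character. *)
Definition torus_orbit_representatives (F : finFieldType)
    (i1 i2 : Iirr (SL2_unip F)) : Prop :=
  [/\ i1 != 0, i2 != 0 &
      if odd #|F| then
        ~ exists2 s, s \in SL2_torus F & 'chi_i2 = ('chi_i1 ^ s)%CF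
      else i1 = i2].

(* The representation rK over K becomes isomorphic to the complex
   representation rC over a common overfield L; algC serves as the field of
   complex numbers, as in the library's character theory. *)
Definition realises (K L : fieldType) (sigma : {rmorphism algC -> L})
    (tau : {rmorphism K -> L}) (gT : finGroupType) (G : {group gT}) (n m : nat)
    (rC : mx_representation algC G n) (rK : mx_representation K G m) : Prop :=
  mx_rsim (map_repr sigma rC) (map_repr tau rK).

Definition irreducibles_realisable (K L : fieldType)
    (sigma : {rmorphism algC -> L}) (tau : {rmorphism K -> L})
    (gT : finGroupType) (G : {group gT}) : Prop :=
  forall (n : nat) (rC : mx_representation algC G n), mx_irreducible rC ->
    exists rK : mx_representation K G n, realises sigma tau rC rK.

(* The values of 'chi_i need not lie in K. *)
Definition Gelfand_Graev (F : finFieldType) (K L : fieldType)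
    (sigma : {rmorphism algC -> L}) (tau : {rmorphism K -> L})
    (i : Iirr (SL2_unip F)) (n : nat)
    (Gam : mx_representation K (SL2_group F) n) : Prop :=
  exists (m : nat) (rC : mx_representation algC (SL2_group F) m),
    cfRepr rC = 'Ind[SL2_group F, SL2_unip F] 'chi_i /\
    realises sigma tau rC Gam.

Section SymmetricPower.
Variable k : fieldType.
Implicit Types (g h : 'M[k]_2) (P : {poly k}).

(* Degree d forms in (e0, e1) are written as polynomials of degree <= d by
   e0 := 1, e1 := 'X, so that the basis monomial e0^(d-i) e1^i becomes 'X^i; the
   row vector e_i *m g is g i 0 *: e0 + g i 1 *: e1. *)
Definition row_form g (i : 'I_2) : {poly k} := (g i 0)%:P + g i 1 *: 'X.

Definition sym_mx (d : nat) g : 'M[k]_d.+1 :=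
  \matrix_(i, j) (row_form g 0 ^+ (d - i) * row_form g 1 ^+ i)`_j.

Definition form_subst (d : nat) g P : {poly k} :=
  \sum_(i < d.+1) P`_i *: (row_form g 0 ^+ (d - i) * row_form g 1 ^+ i).

Lemma form_subst_is_linear d g : linear (form_subst d g).
Proof.
move=> a P Q; rewrite /form_subst scaler_sumr -big_split /=.
by apply: eq_bigr => i _; rewrite coefD coefZ scalerDl scalerA.
Qed.

HB.instance Definition _ d g := GRing.isLinear.Build k {poly k} {poly k} _
  (form_subst d g) (form_subst_is_linear d g).

Lemma form_substXn d g m : (m <= d)%N ->
  form_subst d g 'X^m = row_form g 0 ^+ (d - m) * row_form g 1 ^+ m.
Proof.
move=> le_md; rewrite /form_subst (bigD1 (inord m)) //= inordK //.
rewrite coefXn eqxx scale1r big1 ?addr0 // => i ne_im.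
rewrite coefXn; case: eqP => [eq_im|_]; last by rewrite scale0r.
by case/eqP: ne_im; apply: val_inj; rewrite /= inordK.
Qed.

Lemma row_formM g h i :
  row_form (g *m h) i = g i 0 *: row_form h 0 + g i 1 *: row_form h 1.
Proof.
rewrite /row_form !mxE !big_ord_recl !big_ord0 /=.
have -> : fintype.lift ord0 ord0 = 1 :> 'I_2 by exact/val_inj.
have -> : ord0 = 0 :> 'I_2 by [].
rewrite !addr0 !scalerDr !scalerA scalerDl !polyCD !polyCM !mul_polyC.
by rewrite -!addrA; congr (_ + _); rewrite addrCA.
Qed.

Lemma form_subst_mul_row d g h i P : (size P <= d.+1)%N ->
  form_subst d.+1 h (row_form g i * P)
    = row_form (g *m h) i * form_subst d h P.
Proof.
move=> szP; rewrite -(coefK P) poly_def linear_sum !mulr_sumr linear_sum.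
apply: eq_bigr => m _; rewrite -scalerAr !linearZ /= -scalerAr; congr (_ *: _).
have le_md : (m <= d)%N by rewrite -ltnS; apply: leq_trans (ltn_ord m) szP.
rewrite {1}/row_form mulrDl mul_polyC -scalerAl -exprS linearD /=.
rewrite !linearZ /= !form_substXn ?(leqW le_md) // row_formM subSn // subSS.
rewrite mulrDl -!scalerAl (exprS (row_form h 1)) (exprS (row_form h 0)).
by rewrite -mulrA (mulrCA (row_form h 1)).
Qed.

Lemma size_row_form g i : (size (row_form g i) <= 2)%N.
Proof.
rewrite (leq_trans (size_polyD _ _)) // geq_max.
rewrite (leq_trans (size_polyC_leq1 _)) //=.
by rewrite (leq_trans (size_scale_leq _ _)) ?size_polyX.
Qed.

Lemma size_row_form_prod g a b :
  (size (row_form g 0 ^+ a * row_form g 1 ^+ b)%R <= (a + b).+1)%N.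
Proof.
have szM i P n : (size P <= n.+1)%N -> (size (row_form g i * P)%R <= n.+2)%N.
  move=> szP; apply: leq_trans (size_polyMleq _ _) _.
  by move: (leq_add (size_row_form g i) szP); case: (_ + _)%N.
elim: a => [|a IHa]; last by rewrite exprS -mulrA addSn; apply: szM.
elim: b => [|b IHb]; first by rewrite !expr0 mulr1 size_poly1.
by move: IHb; rewrite !expr0 !mul1r !add0n exprS; apply: szM.
Qed.

Lemma form_subst_row_form_prod g h a b :
  form_subst (a + b) h (row_form g 0 ^+ a * row_form g 1 ^+ b)
    = row_form (g *m h) 0 ^+ a * row_form (g *m h) 1 ^+ b.
Proof.
elim: a => [|a IHa].
  elim: b => [|b IHb].
    by rewrite !expr0 !mulr1 -[1](expr0 'X) form_substXn // !expr0 mulr1.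
  move: IHb; rewrite !expr0 !mul1r !add0n => IHb; rewrite exprS form_subst_mul_row.
    by rewrite IHb -exprS.
  by have := size_row_form_prod g 0 b; rewrite expr0 mul1r.
rewrite exprS -mulrA addSn form_subst_mul_row ?size_row_form_prod //.
by rewrite IHa mulrA -exprS.
Qed.

Lemma sym_mx1 d : sym_mx d 1%:M = 1%:M.
Proof.
apply/matrixP=> i j; rewrite !mxE /row_form !mxE /= scale0r scale1r addr0.
by rewrite polyC0 add0r polyC1 expr1n mul1r coefXn eq_sym.
Qed.

Lemma sym_mxM d g h : sym_mx d (g *m h) = sym_mx d g *m sym_mx d h.
Proof.
apply/matrixP=> i j; rewrite !mxE.
have le_id : (i <= d)%N by rewrite -ltnS.
rewrite -form_subst_row_form_prod subnK // /form_subst coef_sum.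
by apply: eq_bigr => m _; rewrite coefZ !mxE.
Qed.

Variables (F : finFieldType) (iF : {rmorphism F -> k}).

Lemma sym_repr_subproof d :
  mx_repr (SL2_group F) (fun x => sym_mx d (map_mx iF (GL2_mx x))).
Proof.
split=> [|x y _ _]; first by rewrite GL2_mx1 map_mx1 sym_mx1.
by rewrite GL2_mxM map_mxM sym_mxM.
Qed.

Definition Sym_repr d : mx_representation k (SL2_group F) d.+1 :=
  MxRepresentation (sym_repr_subproof d).

End SymmetricPower.

(* Main.v *)
Require Import Defs.
From mathcomp Require Import all_boot all_order all_algebra all_fingroup.
From mathcomp Require Import all_solvable all_field all_character.
From mathcomp Require Import boolp classical_sets freeg.
From mathcomp Require Import ring zify.

Set Implicit Arguments.
Unset Strict Implicit.
Unset Printing Implicit Defensive.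

Import GRing.Theory Num.Theory.
Local Open Scope ring_scope.

(* Two families of kG-modules whose characteristic polynomials agree at every
   p-regular element of G have the same sum in G_0(kG) (Brauer-Nesbitt, proved
   here in characteristic p), and the characteristic polynomials of a lattice
   reduce to those of its reduction.  So everything is decided by a comparison
   of characteristic polynomials at a p-regular g in SL_2(F), of order m say.
   As U is a p-group, the character of a Gelfand-Graev representation vanishes
   at the non-trivial powers of g, hence its characteristic polynomial at g is
   (X^m - 1)^((q^2-1)/m).  On the other side let a, a^-1 be the eigenvalues of
   g; those on V_d are the a^(d-2i).  The weights of
   2 (V_1 + ... + V_(q-2)) + V_0 + V_(q-1), together with one more 0, are the
   differences i - j with 0 <= i, j < q, and the order m of a divides q - 1 or
   q + 1, so each m-th root of unity occurs equally often in
   2 (V_1 + ... + V_(q-2)) + V_0 + V_(q-1). *)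

(** * Characteristic polynomials on the Grothendieck group *)

(** The sizes are kept apart, as in [mx_rsim], where they are equal only by a proof. *)
Lemma char_poly_sim (R : fieldType) n m (A : 'M[R]_n) (B : 'M[R]_m)
    (P : 'M[R]_(n, m)) :
  n = m -> row_free P -> A *m P = P *m B -> char_poly A = char_poly B.
Proof.
move=> eq_nm; subst m; rewrite row_free_unit => uP AP.
suff: \det (map_mx polyC P) * char_poly A = \det (map_mx polyC P) * char_poly B.
  by apply: mulfI; rewrite det_map_mx polyC_eq0 -unitfE -unitmxE.
rewrite mulrC -!det_mulmx; congr (\det _).
rewrite /char_poly_mx mulmxBl mulmxBr -!map_mxM AP; congr (_ - _).
by rewrite scalar_mxC.
Qed.

(* A function [a : gT -> A] stands for the element [\sum_(g in G) a g * g] of the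
   group algebra. *)
Section GroupAlgebra.
Variables (A : fieldType) (gT : finGroupType) (G : {group gT}).
Implicit Types (M S T : fgmod A G) (a b : gT -> A).

Definition galg_act M a : 'M[A]_(tag M) := \sum_(g in G) a g *: tagged M g.

Definition galg_char_poly M a : {poly A} := char_poly (galg_act M a).

Definition galg_elt (x : gT) : gT -> A := fun g => (g == x)%:R.

Lemma galg_act_elt M x : x \in G -> galg_act M (galg_elt x) = tagged M x.
Proof.
move=> Gx; rewrite /galg_act (bigD1 x) //= /galg_elt eqxx scale1r big1 ?addr0 //.
by move=> g /andP[_ /negPf->]; rewrite scale0r.
Qed.

Lemma galg_actD M a b : galg_act M (fun g => a g + b g) = galg_act M a + galg_act M b.
Proof.
by rewrite /galg_act -big_split; apply: eq_bigr => g _ /=; rewrite scalerDl.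
Qed.

Lemma galg_actZ M c a : galg_act M (fun g => c * a g) = c *: galg_act M a.
Proof. by rewrite /galg_act scaler_sumr; apply: eq_bigr => g _; rewrite scalerA. Qed.

Lemma galg_act_sum M (I : finType) (a_ : I -> gT -> A) :
  galg_act M (fun g => \sum_i a_ i g) = \sum_i galg_act M (a_ i).
Proof.
rewrite /galg_act [RHS]exchange_big; apply: eq_bigr => g _ /=.
by rewrite scaler_suml.
Qed.

Definition galg_mul a b : gT -> A :=
  fun x => \sum_(g in G) a g * b (g^-1 * x)%g.

Lemma galg_actM M a b : galg_act M (galg_mul a b) = galg_act M a *m galg_act M b.
Proof.
rewrite /galg_act mulmx_suml.
transitivity (\sum_(x in G) \sum_(g in G) (a g * b (g^-1 * x)%g) *: tagged M x).
  by apply: eq_bigr => x _; rewrite scaler_suml.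
rewrite exchange_big; apply: eq_bigr => g Gg /=.
rewrite mulmx_sumr (reindex_inj (mulgI g)) /=.
apply: eq_big => [h|h Gh]; first by rewrite groupMl.
rewrite groupMl // in Gh.
by rewrite mulKg repr_mxM // -scalemxAl -scalemxAr scalerA.
Qed.

Lemma galg_act_intertwine M1 M2 (f : 'M_(tag M1, tag M2)) :
  {in G, forall x, tagged M1 x *m f = f *m tagged M2 x} ->
  forall a, galg_act M1 a *m f = f *m galg_act M2 a.
Proof.
move=> fG a; rewrite mulmx_suml mulmx_sumr; apply: eq_bigr => g Gg.
by rewrite -scalemxAl fG // scalemxAr.
Qed.

Lemma short_exact_dim M1 M M2 : short_exact M1 M M2 ->
  tag M = (tag M1 + tag M2)%N.
Proof.
case=> f [g [_ _ ff /eqmxP eqfg fg]]; have := mxrank_ker g.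
by rewrite -eqfg (eqP ff) (eqP fg) => ->; rewrite subnK // -(eqP fg) rank_leq_row.
Qed.

(** A linear section [h] of [g] completes [f] to a basis of M, in which a acts by a block lower
    triangular matrix with its actions on M1 and M2 as diagonal blocks. *)
Lemma short_exact_char_poly M1 M M2 : short_exact M1 M M2 ->
  forall a, galg_char_poly M a = galg_char_poly M1 a * galg_char_poly M2 a.
Proof.
move=> ses a; have dimM := short_exact_dim ses.
case: ses => f [g [fG gG ff kerf fg]].
have [h hg] : exists h, h *m g = 1%:M by apply/row_fullP.
pose P := col_mx f (h).
have fg0 : f *m g = 0 by apply/sub_kermxP; rewrite (eqmxP kerf).
(* [P] is square only along [dimM]. Its rows span, since v = (v - v g h) + v g h with the first term
   in ker g = im f. *)
have freeP : row_free P.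
  apply/row_freeP; suff [Q QP]: exists Q, Q *m P = 1%:M.
    move: P Q QP {ff kerf fg0 fG hg}; clear -dimM.
    move=> P; move: dimM; move: (tag M) P => n P En; subst n.
    by move=> Q /mulmx1C QP; exists Q.
  apply/row_fullP; rewrite -sub1mx; apply/row_subP=> i.
  move: (row i 1%:M) => {i} v.
  rewrite -[v](subrK (v *m g *m h)) -addsmxE.
  apply: addmx_sub_adds; last exact: submxMl.
  rewrite (eqmxP kerf); apply/sub_kermxP.
  by rewrite mulmxBl -!mulmxA hg mulmx1 subrr.
(* [h] commutes with a modulo ker g = im f; [C] records the defect. *)
have [C EC]: exists C, h *m galg_act M a = C *m f + galg_act M2 a *m h.
  suff /submxP[C EC]: (h *m galg_act M a - galg_act M2 a *m h <= f)%MS.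
    by exists C; rewrite -EC subrK.
  rewrite (eqmxP kerf); apply/sub_kermxP.
  rewrite mulmxBl -!mulmxA hg mulmx1 (galg_act_intertwine gG) mulmxA hg mul1mx.
  by rewrite subrr.
pose B := block_mx (galg_act M1 a) 0 C (galg_act M2 a).
have EP : B *m P = P *m galg_act M a.
  rewrite /B /P mul_block_col mul_col_mx mul0mx addr0 EC.
  by rewrite -(galg_act_intertwine fG).
rewrite /galg_char_poly -(char_poly_sim _ freeP EP) //.
rewrite /char_poly -(det_lblock _ (- map_mx polyC C)); congr (\det _).
rewrite /char_poly_mx /B map_block_mx map_mx0 scalar_mx_block.
by rewrite opp_block_mx add_block_mx oppr0 addr0 sub0r.
Qed.

Definition fgclass M : G0 A G := G0_class (tagged M).

Lemma fgclassE M :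
  fgclass M = (\pi_(Quotient.quot (@ses_subgroup A gT G)) << M >>)%qT.
Proof. by rewrite /fgclass /G0_class /to_fgmod; case: M. Qed.

Lemma fgclass_ses M1 M M2 : short_exact M1 M M2 ->
  fgclass M = fgclass M1 + fgclass M2.
Proof.
move=> ses; apply/eqP; rewrite !fgclassE -subr_eq0 opprD addrA -!raddfB /=.
rewrite -[X in _ == X](raddf0 (\pi_(Quotient.quot (@ses_subgroup A gT G)))%qT).
rewrite -Quotient.idealrBE subr0; apply/asboolP.
exact: ses_relation_ses.
Qed.

Lemma mx_repr0 : mx_repr G (fun _ : gT => 0 : 'M[A]_0).
Proof. by split=> [|x y _ _]; apply/matrixP=> - []. Qed.

Definition fgmod0 : fgmod A G := to_fgmod (MxRepresentation mx_repr0).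

(** For a zero module M the sequence 0 -> M -> M -> M -> 0 is exact, so [M] = [M] + [M]. *)
Lemma fgclass_dim0 M : tag M = 0%N -> fgclass M = 0.
Proof.
case: M => n rM /= n0; subst n; set M := existT _ _ _.
suff /fgclass_ses /esym: short_exact M M M by rewrite -[RHS]addr0 => /addrI.
exists 0, 0; split=> [x _|x _|||]; rewrite ?/row_free ?/row_full ?mxrank0 //.
- by rewrite [_ *m _]flatmx0 [RHS]flatmx0.
- by rewrite [_ *m _]flatmx0 [RHS]flatmx0.
- by rewrite [kermx _]flatmx0 !submx_refl.
Qed.

Lemma fgclass_rsim M1 M2 : mx_rsim (tagged M1) (tagged M2) ->
  fgclass M1 = fgclass M2.
Proof.
case=> B eq12 fB BG.
suff /fgclass_ses->: short_exact M1 M2 fgmod0.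
  by rewrite (fgclass_dim0 (M := fgmod0)) ?addr0.
exists B, 0; split=> //.
- by move=> x _; rewrite !thinmx0.
- apply/eqmxP; apply: eqmx_trans (eqmx_sym (@kermx0 _ _ _)).
  by apply/eqmxP; rewrite submx1 sub1mx /row_full (eqP (fB : _ == _)) eq12 !eqxx.
- by rewrite /row_full mxrank0.
Qed.

Lemma char_poly_rsim M1 M2 : mx_rsim (tagged M1) (tagged M2) ->
  forall a, galg_char_poly M1 a = galg_char_poly M2 a.
Proof.
by case=> B eq12 fB BG a; apply: char_poly_sim eq12 fB (galg_act_intertwine BG a).
Qed.

(** A relation is kept as a difference of two families with equal products, so that characteristic
    polynomials never have to be inverted. *)
Lemma ses_relation_char_poly u : @ses_relation A gT G u ->
  exists s t : seq (fgmod A G),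
    u = \sum_(M <- s) << M >> - \sum_(M <- t) << M >> /\
    forall a, \prod_(M <- s) galg_char_poly M a = \prod_(M <- t) galg_char_poly M a.
Proof.
elim=> [|M1 M M2 ses|v w _ [sv [tv [-> Ev]]] _ [sw [tw [-> Ew]]]].
- by exists [::], [::]; rewrite !big_nil subrr.
- exists [:: M], [:: M1; M2]; split=> [|a].
    by rewrite !big_cons !big_nil !addr0 opprD addrA.
  by rewrite !big_cons !big_nil !mulr1 (short_exact_char_poly ses).
exists (sv ++ tw), (tv ++ sw); split=> [|a]; rewrite !big_cat /=.
  by rewrite opprB opprD addrACA.
by rewrite Ev Ew.
Qed.

Lemma coeff_sum_freeg (s : seq (fgmod A G)) M :
  coeff M (\sum_(N <- s) << N >> : {freeg (fgmod A G)}) = (count_mem M s)%:Z.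
Proof.
elim: s => [|N s IHs]; first by rewrite big_nil coeff0.
by rewrite big_cons coeffD coeffU mul1r IHs /= PoszD; congr (_ + _); case: eqP.
Qed.

Lemma sum_freeg_perm (s t : seq (fgmod A G)) :
  \sum_(M <- s) << M >> = \sum_(M <- t) << M >> :> {freeg (fgmod A G)} -> perm_eq s t.
Proof.
move=> E; apply/allP=> M _ /=; apply/eqP.
by have := congr1 (coeff M) E; rewrite !coeff_sum_freeg => - [].
Qed.

Lemma galg_char_poly_neq0 M a : galg_char_poly M a != 0.
Proof. by rewrite monic_neq0 ?char_poly_monic. Qed.

Lemma fgclass_char_poly M M1 M2 : fgclass M = fgclass M1 - fgclass M2 ->
  forall a, galg_char_poly M1 a = galg_char_poly M2 a * galg_char_poly M a.
Proof.
move=> /eqP; rewrite !fgclassE -raddfB /= -Quotient.idealrBE => /asboolP.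
case/ses_relation_char_poly=> s [t [E Est]] a.
(* Both lists have the same sum in the free group, whose coefficients count multiplicities. *)
have pE: perm_eq (M :: M2 :: t) (M1 :: s).
  apply: sum_freeg_perm; rewrite !big_cons.
  move/eqP: E; rewrite subr_eq => /eqP->.
  by rewrite [<< M2 >> + _]addrC addrACA !subrK addrC.
have: \prod_(N <- [:: M, M2 & t]) galg_char_poly N a
    = \prod_(N <- M1 :: s) galg_char_poly N a.
  exact: perm_big.
rewrite !big_cons Est mulrA => /mulIf<-; first by rewrite mulrC.
elim/big_ind: _ => [|p q|N _]; [exact: oner_neq0|exact: mulf_neq0|].
exact: galg_char_poly_neq0.
Qed.

Lemma short_exact_submod (M : fgmod A G) (U : 'M_(tag M))
    (Umod : mxmodule (tagged M) U) :
  short_exact (to_fgmod (submod_repr Umod)) M (to_fgmod (factmod_repr Umod)).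
Proof.
exists (val_submod 1%:M), (in_factmod U 1%:M); split.
- by move=> x Gx; rewrite -val_submodE -val_submodJ // mul1mx.
- by move=> x Gx; rewrite -in_factmodE -in_factmodJ // mul1mx.
- by rewrite /row_free val_submod1.
- apply/andP; split.
    rewrite val_submod1; apply/sub_kermxP; apply/eqP.
    by rewrite -in_factmodE in_factmod_eq0.
  by rewrite val_submod1 -in_factmod_eq0 in_factmodE mulmx_ker.
- by apply/row_fullP; exists (val_factmod 1%:M); rewrite -in_factmodE val_factmodK.
Qed.

(** Composition factors, by induction on the dimension: a proper non-zero submodule and its quotient
    are both smaller. *)
Lemma fgmod_composition (M : fgmod A G) : exists s : seq (fgmod A G),
  [/\ forall S, S \in s -> mx_irreducible (tagged S),
      fgclass M = \sum_(S <- s) fgclass S &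
      forall a, galg_char_poly M a = \prod_(S <- s) galg_char_poly S a].
Proof.
have [n] := ubnP (tag M); elim: n M => // n IHn M ltMn.
have [M0|M_gt0] := posnP (tag M).
  exists [::]; split=> // [|a]; first by rewrite big_nil fgclass_dim0.
  rewrite big_nil /galg_char_poly; move: (galg_act M a); rewrite M0 => B.
  by rewrite /char_poly det_mx00.
have [irrM|redM] := pselect (mx_irreducible (tagged M)).
  exists [:: M]; split=> [S||a]; rewrite ?big_seq1 //.
  by rewrite inE => /eqP->.
have [U Umod [U0 Uprop]] : exists2 U : 'M_(tag M), mxmodule (tagged M) U &
    U != 0 /\ ~~ row_full U.
  apply: contrapT => noU; apply: redM; apply/mx_irrP; split=> // U Umod U0.
  by apply/negPn/negP=> Uprop; apply: noU; exists U.
have ses := short_exact_submod Umod.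
have dU : (0 < \rank U)%N by rewrite lt0n mxrank_eq0.
have dU' : (\rank U < tag M)%N by rewrite ltn_neqAle rank_leq_col andbT.
have [/=|s1 [irr1 cl1 cp1]] := IHn (to_fgmod (submod_repr Umod)).
  exact: leq_trans dU' _.
have [/=|s2 [irr2 cl2 cp2]] := IHn (to_fgmod (factmod_repr Umod)).
  by rewrite mxrank_coker; lia.
exists (s1 ++ s2); split=> [S||a].
- by rewrite mem_cat => /orP[/irr1|/irr2].
- by rewrite (fgclass_ses ses) big_cat cl1 cl2.
- by rewrite (short_exact_char_poly ses) big_cat cp1 cp2.
Qed.

End GroupAlgebra.

(** * Brauer-Nesbitt theorem in characteristic p *)

Section Irreducible.
Variables (A : fieldType) (gT : finGroupType) (G : {group gT}).
Implicit Types (M S T : fgmod A G) (a b : gT -> A).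

Lemma irr_cyclic S (v w : 'rV_(tag S)) : mx_irreducible (tagged S) -> v != 0 ->
  exists a, w = v *m galg_act S a.
Proof.
move=> /mx_irrP[_ irrS] v0.
have: (w <= cyclic_mx (tagged S) v)%MS.
  by rewrite submx_full // irrS ?cyclic_mx_module // cyclic_mx_eq0.
by case/cyclic_mxP=> B /envelop_mxP[a ->] ->; exists a.
Qed.

(** Schur's lemma on vectors: a non-zero vector of the kernel would generate T, and a non-zero row
    of [f] generates S. *)
Lemma irr_intertwine_rsim T S (f : 'M_(tag T, tag S)) :
  mx_irreducible (tagged T) -> mx_irreducible (tagged S) ->
  {in G, forall x, tagged T x *m f = f *m tagged S x} -> f != 0 ->
  mx_rsim (tagged T) (tagged S).
Proof.
move=> irrT irrS fG f0; have fA := galg_act_intertwine fG.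
have ff : row_free f.
  rewrite -kermx_eq0; apply/rowV0P => v /sub_kermxP vf; apply: contraNeq f0 => v0.
  apply/eqP/row_matrixP=> i; rewrite row0 rowE.
  have [a ->] := irr_cyclic (delta_mx 0 i) irrT v0.
  by rewrite -mulmxA fA mulmxA vf mul0mx.
have [i fi0] : exists i, row i f != 0.
  apply/existsP; apply: contraR f0; rewrite negb_exists => /forallP f0.
  by apply/eqP/row_matrixP=> i; rewrite row0; apply/eqP; have := f0 i; rewrite negbK.
have ffull : row_full f.
  rewrite -sub1mx; apply/row_subP=> j.
  have [a ->] := irr_cyclic (row j 1%:M) irrS fi0.
  by rewrite rowE -mulmxA -fA mulmxA submxMl.
by exists f => //; apply/eqP; rewrite -(eqP ff) (eqP ffull).
Qed.

(* Otherwise take the smallest family Y of vectors of T such that every a with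
   Y a = 0 satisfies s a = 0, remove a vector t from it, and let J be the set of
   the a that kill the remaining ones: then t a |-> s a, a in J, is a nonzero
   homomorphism from t J = T to S. *)
Lemma irr_separate S T (s : 'rV_(tag S)) :
  mx_irreducible (tagged S) -> mx_irreducible (tagged T) ->
  ~ mx_rsim (tagged T) (tagged S) -> s != 0 ->
  exists a, galg_act T a = 0 /\ s *m galg_act S a = s.
Proof.
move=> irrS irrT nTS s0.
(* Some further b brings s a back to s, and a b still kills T. *)
suff [a [Ta Sa]]: exists a, galg_act T a = 0 /\ s *m galg_act S a != 0.
  have [b Sb] := irr_cyclic s irrS Sa; exists (galg_mul G a b).
  by rewrite !galg_actM Ta mul0mx mulmxA -Sb.
apply: contrapT => H0.
pose P j := `[< exists Y : 'M_(j, tag T),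
                  forall a, Y *m galg_act T a = 0 -> s *m galg_act S a = 0 >].
have exP : exists j, P j.
  exists (tag T); apply/asboolP; exists 1%:M => a; rewrite mul1mx => Ta.
  by apply/eqP/negPn/negP => Sa; apply: H0; exists a.
case: (ex_minnP exP) => - [|j] /asboolP[Y HY] minj.
  (* With an empty family every a would satisfy s a = 0, the identity included. *)
  case/eqP: s0; rewrite -[s]mulmx1 -(repr_mx1 (tagged S)) -galg_act_elt //.
  by apply: HY; rewrite [LHS]flatmx0.
have {minj} : ~~ P j by apply/negP => /minj; rewrite ltnn.
move: HY; rewrite -[Y](@vsubmxK _ 1); move: (usubmx _) (dsubmx _) => t Y' HY nPj.
have {}HY a : t *m galg_act T a = 0 -> Y' *m galg_act T a = 0 -> s *m galg_act S a = 0.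
  by move=> ta Y'a; apply: HY; apply: etrans (mul_col_mx t Y' _) _; rewrite ta Y'a col_mx0.
have [x0 [Yx0 sx0]] : exists a, Y' *m galg_act T a = 0 /\ s *m galg_act S a != 0.
  apply: contrapT => H; case/negP: nPj; apply/asboolP; exists Y' => a Ya.
  by apply/eqP/negPn/negP=> sa; apply: H; exists a.
have tx0 : t *m galg_act T x0 != 0 by apply: contraNneq sx0 => tx0; rewrite HY.
(* t J is a non-zero submodule of the simple module T, hence all of T. *)
have ex w : exists x, Y' *m galg_act T x = 0 /\ t *m galg_act T x = w.
  have [y ->] := irr_cyclic w irrT tx0; exists (galg_mul G x0 y).
  by rewrite !galg_actM !mulmxA Yx0 mul0mx.
have [x_ x_P] := choice (fun i => ex (delta_mx 0 i)).
pose f := \matrix_i (s *m galg_act S (x_ i)) : 'M_(tag T, tag S).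
(* The map is well defined: [b] below lies in J and t b = t a, so a - b kills the whole family and s
   a = s b. *)
have fE a : Y' *m galg_act T a = 0 -> t *m galg_act T a *m f = s *m galg_act S a.
  move=> Ya; pose c := t *m galg_act T a.
  pose b g := \sum_i c 0 i * x_ i g.
  have bE M : galg_act M b = \sum_i c 0 i *: galg_act M (x_ i).
    by rewrite galg_act_sum; apply: eq_bigr => i _; rewrite galg_actZ.
  have tb : t *m galg_act T b = c.
    rewrite bE mulmx_sumr [RHS]row_sum_delta; apply: eq_bigr => i _.
    by rewrite -scalemxAr (x_P i).2.
  have Yb : Y' *m galg_act T b = 0.
    rewrite bE mulmx_sumr big1 // => i _.
    by rewrite -scalemxAr (x_P i).1 scaler0.
  have sb : s *m galg_act S b = c *m f.
    rewrite bE mulmx_sumr mulmx_sum_row; apply: eq_bigr => i _.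
    by rewrite -scalemxAr rowK.
  have := HY (fun g => a g + -1 * b g).
  rewrite !galg_actD !galg_actZ !scaleN1r !mulmxBr Ya Yb tb subrr subrr => /(_ erefl erefl).
  by rewrite sb => /eqP; rewrite subr_eq0 => /eqP.
case: nTS; apply: (irr_intertwine_rsim (f := f)) => //.
  move=> g Gg; apply/row_matrixP=> i; rewrite !row_mul rowK -(galg_act_elt T Gg) rowE.
  rewrite -(x_P i).2 -(galg_act_elt S Gg) -(mulmxA t) -galg_actM.
  by rewrite fE galg_actM mulmxA // (x_P i).1 mul0mx.
apply: contraNneq sx0 => f0; rewrite -fE // f0 mulmx0 //.
Qed.

(** A product of separating elements works: each factor fixes s, and a factor that vanishes on T
    makes the product vanish there, on whichever side it stands. *)
Lemma irr_separate_all S (t : seq (fgmod A G)) (s : 'rV_(tag S)) :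
  mx_irreducible (tagged S) ->
  (forall T, T \in t -> mx_irreducible (tagged T) /\ ~ mx_rsim (tagged T) (tagged S)) ->
  s != 0 ->
  exists a, (forall T, T \in t -> galg_act T a = 0) /\ s *m galg_act S a = s.
Proof.
move=> irrS; elim: t => [|T t IHt] Ht s0.
  exists (galg_elt A 1%g); split=> //.
  by rewrite galg_act_elt // repr_mx1 mulmx1.
have [U Ut|a [ta sa]] := IHt _ s0; first by apply: Ht; rewrite inE Ut orbT.
have [irrT nTS] := Ht T (mem_head _ _).
have [b [Tb sb]] := irr_separate irrS irrT nTS s0.
exists (galg_mul G a b); rewrite !galg_actM mulmxA sa; split=> // U; rewrite inE galg_actM.
by case/predU1P=> [->|/ta->]; rewrite ?Tb ?mulmx0 ?mul0mx.
Qed.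

End Irreducible.

(* Minus the trace for a characteristic polynomial; the factor ['X] is there to
   give the polynomial 1, which has no second coefficient, the trace 0. *)
Definition poly_trace (R : nzSemiRingType) (p : {poly R}) : R := ('X * p)`_(size p).-1.

Lemma poly_traceM (R : idomainType) (p q : {poly R}) : p \is monic -> q \is monic ->
  poly_trace (p * q) = poly_trace p + poly_trace q.
Proof.
move=> mp mq; have p0 := monic_neq0 mp; have q0 := monic_neq0 mq.
have decomp (r : {poly R}) : r \is monic ->
    exists2 r' : {poly R}, r = 'X^((size r).-1) + r' & (size r' <= (size r).-1)%N.
  move=> mr; exists (r - 'X^((size r).-1)); first by rewrite addrC subrK.
  apply/leq_sizeP=> j le_rj; rewrite coefB coefXn.
  have [->|ne_j] := eqVneq j; first by rewrite -lead_coefE (monicP mr) subrr.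
  rewrite nth_default ?subrr // -(prednK (n := size r)) ?size_poly_gt0 ?monic_neq0 //.
  by rewrite ltn_neqAle eq_sym ne_j.
have tr (r r' : {poly R}) m : r = 'X^m + r' -> ('X * r)`_m = ('X * r')`_m.
  by move=> ->; rewrite mulrDr coefD -exprS coefXn ltn_eqF ?add0r.
rewrite /poly_trace size_monicM //.
have [p' Ep sp'] := decomp p mp; have [q' Eq sq'] := decomp q mq.
rewrite (tr p p') // (tr q q') //.
have [n np] : exists n, size p = n.+1.
  by exists (size p).-1; rewrite prednK ?size_poly_gt0.
have [m mq'] : exists m, size q = m.+1.
  by exists (size q).-1; rewrite prednK ?size_poly_gt0.
move: sp' sq' Ep Eq; rewrite np mq' addSn addnS /= => sp' sq' -> ->.
(* Below the leading terms, p' q' has too small a degree to reach the second coefficient; only 'X^n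
   q' and p' 'X^m contribute. *)
have small : ('X * (p' * q'))`_(n + m) = 0.
  rewrite coefXM; case: ifP => // _; rewrite nth_default //.
  by apply: leq_trans (size_polyMleq _ _) _; rewrite -!subn1 leq_sub2r // leq_add.
rewrite mulrDl !mulrDr -!exprD -exprS !coefD coefXn ltn_eqF // add0r.
rewrite mulrCA coefXnM ltnNge leq_addr /= addKn addrC; congr (_ + _).
rewrite (mulrA 'X p') coefMXn ltnNge leq_addl /= addnK.
by rewrite small addr0.
Qed.

Lemma poly_trace_prod (R : idomainType) (I : Type) (r : seq I) (P : I -> {poly R}) :
  (forall i, P i \is monic) ->
  poly_trace (\prod_(i <- r) P i) = \sum_(i <- r) poly_trace (P i).
Proof.
move=> mP; elim: r => [|i r IHr]; last first.
  by rewrite !big_cons poly_traceM ?monic_prod // IHr.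
by rewrite !big_nil /poly_trace size_poly1 mulr1 coefX.
Qed.

Lemma poly_traceX (R : idomainType) (p : {poly R}) n : p \is monic ->
  poly_trace (p ^+ n) = poly_trace p *+ n.
Proof.
move=> mp; elim: n => [|n IHn]; last first.
  by rewrite exprS poly_traceM ?rpredX // IHn mulrS.
by rewrite /poly_trace size_poly1 mulr1 coefX.
Qed.

Lemma poly_trace_char_poly (R : idomainType) n (B : 'M[R]_n) :
  poly_trace (char_poly B) = - \tr B.
Proof.
rewrite /poly_trace size_char_poly /= coefXM; case: posnP => [n0|n_gt0].
  by subst n; rewrite /mxtrace big_ord0 oppr0.
by rewrite char_poly_trace.
Qed.

Lemma expr_pchar_inj (R : idomainType) p j : p \in [pchar R] ->
  injective (fun x : R => x ^+ (p ^ j)).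
Proof.
move=> chp x y /= Exy; have pn : [pchar R].-nat (p ^ j)%N.
  by rewrite (eq_pnat _ (pcharf_eq chp)) pnatX pnat_id ?(pcharf_prime chp).
have := exprDn_pchar (x - y) y pn; rewrite subrK Exy -[LHS]add0r => /addIr/esym/eqP.
by rewrite expf_eq0 subr_eq0 => /andP[_ /eqP].
Qed.

Lemma prod_count_mem (R : comNzRingType) (I : eqType) (u r : seq I) (P : I -> R) :
  uniq r -> {subset u <= r} ->
  \prod_(i <- u) P i = \prod_(i <- r) P i ^+ count_mem i u.
Proof.
move=> Ur; elim: u => [|j u IHu] sur.
  by rewrite big_nil big1 // => i _; rewrite expr0.
rewrite big_cons IHu; last by move=> i ui; rewrite sur // inE ui orbT.
under [RHS]eq_bigr => i _ do rewrite /= exprD.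
rewrite big_split /=; congr (_ * _).
rewrite (bigD1_seq j) ?sur ?mem_head //= eqxx big1 ?mulr1 // => i.
by rewrite eq_sym => /negPf->.
Qed.

Section Splitting.
Variables (E : fieldType) (gT : finGroupType) (G : {group gT}).
Hypothesis splitE : group_splitting_field E G.
Implicit Types (S T M : fgmod E G).

Lemma mxtrace_galg_act M (a : gT -> E) :
  \tr (galg_act M a) = \sum_(g in G) a g * \tr (tagged M g).
Proof. by rewrite raddf_sum; apply: eq_bigr => g _ /=; rewrite mxtraceZ. Qed.

Lemma irr_trace_dual S (t : seq (fgmod E G)) : mx_irreducible (tagged S) ->
  (forall T, T \in t -> mx_irreducible (tagged T) /\ ~ mx_rsim (tagged T) (tagged S)) ->
  exists a, \tr (galg_act S a) = 1 /\ forall T, T \in t -> \tr (galg_act T a) = 0.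
Proof.
move=> irrS Ht; have /mx_abs_irrP[S_gt0 [c cE]] := splitE irrS.
pose i0 := Ordinal S_gt0.
have [|a [ta sa]] := irr_separate_all (s := delta_mx 0 i0) irrS Ht.
  by apply/eqP=> /matrixP/(_ 0 i0)/eqP; rewrite !mxE !eqxx oner_eq0.
exists (galg_mul G a (c^~ (delta_mx i0 i0))); split=> [|T /ta Ta].
  rewrite galg_actM /(galg_act S (c^~ _)) -cE.
  rewrite -(mul_delta_mx (0 : 'I_1)) mulmxA mxtrace_mulC mulmxA sa mul_delta_mx.
  by rewrite /mxtrace big_ord1 mxE eqxx.
by rewrite galg_actM Ta mul0mx mxtrace0.
Qed.

(** Second coefficients turn the products into sums of traces, which extend linearly to the group
    algebra. Evaluation at the dual elements of [irr_trace_dual] isolates each multiplicity as an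
    element of E, hence modulo p. *)
Lemma irr_multiplicity_mod (p : nat) (r : seq (fgmod E G)) (m n : fgmod E G -> nat) :
  p \in [pchar E] ->
  (forall S, S \in r -> mx_irreducible (tagged S)) ->
  {in r &, forall S T, mx_rsim (tagged S) (tagged T) -> S = T} -> uniq r ->
  {in G, forall g, \prod_(S <- r) char_poly (tagged S g) ^+ m S
                 = \prod_(S <- r) char_poly (tagged S g) ^+ n S} ->
  {in r, forall S, (m S = n S %[mod p])%N}.
Proof.
move=> chp irr_r r_inj Ur Emn S rS.
have tr_prod (l : fgmod E G -> nat) g :
    poly_trace (\prod_(S <- r) char_poly (tagged S g) ^+ l S)
      = - \sum_(S <- r) (l S)%:R * \tr (tagged S g).
  rewrite poly_trace_prod => [|T]; last by rewrite rpredX ?char_poly_monic.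
  rewrite -sumrN; apply: eq_bigr => T _.
  by rewrite poly_traceX ?char_poly_monic // poly_trace_char_poly mulNrn mulr_natl.
have Etr g : g \in G -> \sum_(S <- r) (m S)%:R * \tr (tagged S g)
                      = \sum_(S <- r) (n S)%:R * \tr (tagged S g).
  by move=> Gg; apply: oppr_inj; rewrite -!tr_prod Emn.
have Eact a : \sum_(S <- r) (m S)%:R * \tr (galg_act S a)
            = \sum_(S <- r) (n S)%:R * \tr (galg_act S a).
  have swap (l : fgmod E G -> nat) : \sum_(S <- r) (l S)%:R * \tr (galg_act S a)
      = \sum_(g in G) a g * \sum_(S <- r) (l S)%:R * \tr (tagged S g).
    under eq_bigr => T _ do rewrite mxtrace_galg_act mulr_sumr.
    rewrite exchange_big; apply: eq_bigr => g _ /=; rewrite mulr_sumr.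
    by apply: eq_bigr => T _; rewrite mulrCA.
  by rewrite !swap; apply: eq_bigr => g Gg; rewrite Etr.
have [|T|a [Sa ta]] := @irr_trace_dual S (rem S r); first exact: irr_r.
  rewrite mem_rem_uniq // inE => /andP[/= nTS rT]; split; first exact: irr_r.
  by move/(r_inj _ _ rT rS) => eTS; rewrite eTS eqxx in nTS.
have := Eact a; have proj (l : fgmod E G -> nat) :
    \sum_(S <- r) (l S)%:R * \tr (galg_act S a) = (l S)%:R.
  rewrite (perm_big _ (perm_to_rem rS)) big_cons Sa mulr1 big_seq big1 /= ?addr0 // => T.
  by move=> /ta->; rewrite mulr0.
rewrite !proj => Ep; apply/eqP.
wlog le_nm : m n {Emn tr_prod Etr Eact proj} Ep / (n S <= m S)%N.
  move=> WL; have [/(WL m n)|/ltnW/(WL n m)] := leqP (n S) (m S); first exact.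
  by rewrite eq_sym; apply.
by rewrite eqn_mod_dvd // (dvdn_pcharf chp) natrB // Ep subrr.
Qed.

(* The multiplicities are compared modulo p^j by induction on j: cancel the
   common remainders modulo p^j and take p^j-th roots of both products. *)
Lemma irr_multiplicity_eq (p : nat) (r : seq (fgmod E G)) (m n : fgmod E G -> nat) :
  p \in [pchar E] ->
  (forall S, S \in r -> mx_irreducible (tagged S)) ->
  {in r &, forall S T, mx_rsim (tagged S) (tagged T) -> S = T} -> uniq r ->
  {in G, forall g, \prod_(S <- r) char_poly (tagged S g) ^+ m S
                 = \prod_(S <- r) char_poly (tagged S g) ^+ n S} ->
  {in r, m =1 n}.
Proof.
move=> chp irr_r r_inj Ur Emn S rS.
(* Congruence modulo p^(m S + n S), which exceeds both numbers, is equality. *)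
suff mod_pj j : {in r, forall S, (m S = n S %[mod p ^ j])%N}.
  have p_gt1 := prime_gt1 (pcharf_prime chp).
  have := mod_pj (m S + n S)%N S rS.
  have lt_pj := ltn_expl (m S + n S) p_gt1.
  by rewrite !modn_small //; apply: leq_ltn_trans lt_pj; rewrite ?leq_addl ?leq_addr.
elim: j {S rS} => [|j IHj] S rS; first by rewrite expn0 !modn1.
have pj_gt0 : (0 < p ^ j)%N by rewrite expn_gt0 prime_gt0 // (pcharf_prime chp).
have step : {in r, forall S, (m S %/ p ^ j = n S %/ p ^ j %[mod p])%N}.
  apply: irr_multiplicity_mod => // g Gg.
  have chpX : p \in [pchar {poly E}] by rewrite pchar_poly.
  apply: (@expr_pchar_inj _ _ j chpX); rewrite /= -!prodrXl.
  have split_exp (l : fgmod E G -> nat) :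
      \prod_(S <- r) char_poly (tagged S g) ^+ l S
    = \prod_(S <- r) (char_poly (tagged S g) ^+ (l S %/ p ^ j)) ^+ (p ^ j)
      * \prod_(S <- r) char_poly (tagged S g) ^+ (l S %% p ^ j).
    by rewrite -big_split /=; apply: eq_bigr => T _; rewrite -exprM -exprD -divn_eq.
  have := Emn g Gg; rewrite (split_exp m) (split_exp n).
  rewrite [X in _ * X = _ -> _]big_seq [X in _ = _ * X -> _]big_seq.
  rewrite [X in _ * X = _ -> _](eq_bigr
    (fun S => char_poly (tagged S g) ^+ (n S %% p ^ j))).
    apply: mulIf; rewrite monic_neq0 // monic_prod // => T _.
    by rewrite rpredX ?char_poly_monic.
  by move=> T rT; rewrite IHj.
have := step S rS; move: (IHj S rS); set Q := (p ^ j)%N in pj_gt0 * => Er Eq.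
rewrite (divn_eq (m S) Q) (divn_eq (n S) Q) Er expnS.
apply/eqP; rewrite eqn_modDr; apply/eqP.
by rewrite -!muln_modl // Eq.
Qed.

End Splitting.

Definition rsim_repr (A : fieldType) (gT : finGroupType) (G : {group gT})
    (S : fgmod A G) : fgmod A G :=
  xget (fgmod0 A G) [set T | mx_rsim (tagged S) (tagged T)]%classic.

Lemma rsim_reprP (A : fieldType) (gT : finGroupType) (G : {group gT})
  (S : fgmod A G) : mx_rsim (tagged S) (tagged (rsim_repr S)).
Proof.
pose P := [set T | mx_rsim (tagged S) (tagged T)]%classic.
by apply: (@xgetPex _ (fgmod0 A G) P); exists S; apply: mx_rsim_refl.
Qed.

Lemma rsim_repr_eq (A : fieldType) (gT : finGroupType) (G : {group gT})
  (S T : fgmod A G) : mx_rsim (tagged S) (tagged T) -> rsim_repr S = rsim_repr T.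
Proof.
move=> ST; rewrite /rsim_repr; congr (xget _ _); apply/seteqP; split=> U /=.
  by apply: mx_rsim_trans; apply: mx_rsim_sym.
exact: mx_rsim_trans.
Qed.

Lemma fgmod_compositions (A : fieldType) (gT : finGroupType) (G : {group gT})
    (s : seq (fgmod A G)) : exists s' : seq (fgmod A G),
  [/\ forall S, S \in s' -> mx_irreducible (tagged S),
      \sum_(M <- s) fgclass M = \sum_(S <- s') fgclass S &
      forall a, \prod_(M <- s) galg_char_poly M a = \prod_(S <- s') galg_char_poly S a].
Proof.
elim: s => [|M s [s' [irr' cl' cp']]].
  by exists [::]; split=> // [|a]; rewrite !big_nil.
have [s1 [irr1 cl1 cp1]] := fgmod_composition M; exists (s1 ++ s'); split=> [S||a].
- by rewrite mem_cat => /orP[/irr1|/irr'].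
- by rewrite big_cons big_cat cl1 cl'.
- by rewrite big_cons big_cat cp1 cp'.
Qed.

(** Passage from the elements of G to the whole group algebra: the former already determine the
    multiplicities of the composition factors. *)
Lemma split_char_poly_eq_galg (E : fieldType) (gT : finGroupType) (G : {group gT})
    (p : nat) (s t : seq (fgmod E G)) :
  p \in [pchar E] -> group_splitting_field E G ->
  {in G, forall g, \prod_(M <- s) char_poly (tagged M g)
                 = \prod_(M <- t) char_poly (tagged M g)} ->
  forall a, \prod_(M <- s) galg_char_poly M a = \prod_(M <- t) galg_char_poly M a.
Proof.
move=> chp splitE Est a.
have [s' [irr_s _ cps]] := fgmod_compositions s.
have [t' [irr_t _ cpt]] := fgmod_compositions t.
have cp_elt g (M : fgmod E G) : g \in G ->
    char_poly (tagged M g) = galg_char_poly M (galg_elt E g).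
  by move=> Gg; rewrite /galg_char_poly galg_act_elt.
have {}Est : {in G, forall g, \prod_(S <- s') char_poly (tagged S g)
                            = \prod_(S <- t') char_poly (tagged S g)}.
  move=> g Gg; have:= Est g Gg.
  under eq_bigr => M _ do rewrite cp_elt //.
  under [in RHS]eq_bigr => M _ do rewrite cp_elt //.
  rewrite cps cpt => Eg.
  under eq_bigr => M _ do rewrite cp_elt //.
  by under [in RHS]eq_bigr => M _ do rewrite cp_elt //.
rewrite cps cpt {cps cpt}.
(* One representative of each simple module that occurs on either side. *)
pose r := undup (map (@rsim_repr E gT G) (s' ++ t')).
have irr_r S : S \in r -> mx_irreducible (tagged S).
  rewrite mem_undup => /mapP[T sT ->]; apply: mx_rsim_irr (rsim_reprP T) _.
  by move: sT; rewrite mem_cat => /orP[/irr_s|/irr_t].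
have r_inj : {in r &, forall S T, mx_rsim (tagged S) (tagged T) -> S = T}.
  move=> S T; rewrite !mem_undup => /mapP[S' _ ->] /mapP[T' _ ->] ST.
  apply: rsim_repr_eq; apply: mx_rsim_trans (rsim_reprP S') _.
  by apply: mx_rsim_trans ST _; apply: mx_rsim_sym; apply: rsim_reprP.
have count_r (u : seq (fgmod E G)) b : {subset u <= s' ++ t'} ->
    \prod_(S <- u) galg_char_poly S b =
    \prod_(S <- r) galg_char_poly S b ^+ count_mem S (map (@rsim_repr E gT G) u).
  move=> su; rewrite -prod_count_mem ?undup_uniq //; last first.
    by move=> S /mapP[T /su sT ->]; rewrite mem_undup map_f.
  by rewrite big_map; apply: eq_bigr => S _; apply: char_poly_rsim (rsim_reprP S) b.
have sub_s : {subset s' <= s' ++ t'} by move=> S; rewrite mem_cat => ->.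
have sub_t : {subset t' <= s' ++ t'} by move=> S; rewrite mem_cat orbC => ->.
rewrite !count_r //; apply: eq_big_seq => S rS; congr (_ ^+ _).
pose m u S := count_mem S (map (@rsim_repr E gT G) u).
apply: (irr_multiplicity_eq (m := m s') (n := m t')
  splitE chp irr_r r_inj (undup_uniq _)) rS.
move=> g Gg; have := Est g Gg.
under eq_bigr => M _ do rewrite cp_elt //.
under [in RHS]eq_bigr => M _ do rewrite cp_elt //.
rewrite !count_r // => Eg.
under eq_bigr => M _ do rewrite cp_elt //.
by under [in RHS]eq_bigr => M _ do rewrite cp_elt //.
Qed.

Definition map_fgmod (A E : fieldType) (f : {rmorphism A -> E}) (gT : finGroupType)
    (G : {group gT}) (M : fgmod A G) : fgmod E G := to_fgmod (map_repr f (tagged M)).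

Lemma map_galg_char_poly (A E : fieldType) (f : {rmorphism A -> E}) (gT : finGroupType)
    (G : {group gT}) (M : fgmod A G) a :
  galg_char_poly (map_fgmod f M) (f \o a) = map_poly f (galg_char_poly M a).
Proof.
rewrite /galg_char_poly map_char_poly; congr char_poly.
by rewrite map_mx_sum; apply: eq_bigr => g _; rewrite map_mxZ.
Qed.

Section BrauerNesbitt.
Variables (k : fieldType) (gT : finGroupType) (G : {group gT}).
Implicit Types (S T M : fgmod k G) (s t : seq (fgmod k G)).

(** Scalars are extended to a splitting field, where the products are compared; extension is
    injective on polynomials. *)
Lemma char_poly_eq_galg (p : nat) s t : p \in [pchar k] ->
  {in G, forall g, \prod_(M <- s) char_poly (tagged M g)
                 = \prod_(M <- t) char_poly (tagged M g)} ->
  forall a, \prod_(M <- s) galg_char_poly M a = \prod_(M <- t) galg_char_poly M a.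
Proof.
move=> chp Est a; apply/asboolP.
apply: (@group_splitting_field_exists _ G k) => - [E f splitE]; apply/asboolP.
have mapE u : map_poly f (\prod_(M <- u) galg_char_poly M a)
    = \prod_(N <- [seq map_fgmod f M | M <- u]) galg_char_poly N (f \o a).
  by rewrite rmorph_prod big_map; apply: eq_bigr => M _; rewrite map_galg_char_poly.
apply: (map_poly_inj f); rewrite !mapE.
apply: (split_char_poly_eq_galg (p := p)) => //; first exact: rmorph_pchar chp.
have mapgE u g : \prod_(N <- [seq map_fgmod f M | M <- u]) char_poly (tagged N g)
    = map_poly f (\prod_(M <- u) char_poly (tagged M g)).
  by rewrite rmorph_prod big_map; apply: eq_bigr => M _; exact: esym (map_char_poly f _).
by move=> g Gg; rewrite !mapgE Est.
Qed.

(** Otherwise some a fixes a non-zero vector of S and kills every T in [t]; then 1 is a root of the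
    left product, but not of the right one. *)
Lemma irr_occurs S s t : mx_irreducible (tagged S) ->
  (forall T, T \in t -> mx_irreducible (tagged T)) ->
  (forall a, \prod_(M <- S :: s) galg_char_poly M a = \prod_(M <- t) galg_char_poly M a) ->
  exists2 T, T \in t & mx_rsim (tagged T) (tagged S).
Proof.
move=> irrS irrt Est; apply: contrapT => noT.
have [S_gt0 _] := (mx_irrP _).1 irrS.
pose v : 'rV[k]_(tag S) := delta_mx 0 (Ordinal S_gt0).
have v0 : v != 0.
  by apply/eqP=> /matrixP/(_ 0 (Ordinal S_gt0))/eqP; rewrite !mxE !eqxx oner_eq0.
have [T tT|a [ta va]] := irr_separate_all (t := t) irrS _ v0.
  by split; [apply: irrt | move=> TS; apply: noT; exists T].
have : root (\prod_(M <- t) galg_char_poly M a) 1.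
  rewrite -Est big_cons rootM /galg_char_poly -eigenvalue_root_char.
  by apply/orP; left; apply/eigenvalueP; exists v; rewrite ?scale1r.
apply/negP; rewrite big_seq; elim/big_ind: _ => [|P Q|T tT].
- exact: root1.
- by rewrite rootM negb_or => -> ->.
rewrite /galg_char_poly -eigenvalue_root_char ta //; apply/eigenvalueP => - [u].
by rewrite mulmx0 scale1r => <-; rewrite eqxx.
Qed.

(** The simple modules are matched and cancelled one at a time. *)
Lemma irr_char_poly_fgclass s t :
  (forall S, S \in s -> mx_irreducible (tagged S)) ->
  (forall T, T \in t -> mx_irreducible (tagged T)) ->
  (forall a, \prod_(M <- s) galg_char_poly M a = \prod_(M <- t) galg_char_poly M a) ->
  \sum_(M <- s) fgclass M = \sum_(M <- t) fgclass M.
Proof.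
elim: s t => [|S s IHs] t irrs irrt Est.
  case: t irrt Est => // T t irrt Est.
  by have [] := irr_occurs (irrt T (mem_head _ _)) irrs (fun a => esym (Est a)).
have [T tT TS] := irr_occurs (irrs S (mem_head _ _)) irrt Est.
rewrite big_cons (perm_big _ (perm_to_rem tT)) big_cons /= (fgclass_rsim TS).
congr (_ + _); apply: IHs => [U sU|U /mem_rem/irrt //|a].
  by apply: irrs; rewrite inE sU orbT.
have := Est a; rewrite big_cons [RHS](perm_big _ (perm_to_rem tT)) big_cons /=.
rewrite (char_poly_rsim TS) => /mulfI; apply; exact: galg_char_poly_neq0.
Qed.

Theorem char_poly_fgclass (p : nat) s t : p \in [pchar k] ->
  {in G, forall g, \prod_(M <- s) char_poly (tagged M g)
                 = \prod_(M <- t) char_poly (tagged M g)} ->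
  \sum_(M <- s) fgclass M = \sum_(M <- t) fgclass M.
Proof.
move=> chp /(char_poly_eq_galg chp) Est.
have [s' [irr_s -> cps]] := fgmod_compositions s.
have [t' [irr_t -> cpt]] := fgmod_compositions t.
by apply: irr_char_poly_fgclass => // a; rewrite -cps -cpt.
Qed.

End BrauerNesbitt.

(** * Reduction to p-regular elements *)

Lemma exprBn_comm_pchar (R : nzRingType) p j (x y : R) : p \in [pchar R] ->
  GRing.comm x y -> (x - y) ^+ (p ^ j) = x ^+ (p ^ j) - y ^+ (p ^ j).
Proof.
move=> chp; elim: j x y => [|j IHj] x y cxy; first by rewrite !expr1.
rewrite expnS !exprM -IHj; last exact/commrX/commr_sym/commrX/commr_sym.
by rewrite -!(pFrobenius_autE chp) pFrobenius_autB_comm.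
Qed.

(* Both characteristic polynomials have the same [p ^ j]-th power, by
   [det (X - B)^(p^j) = det (X^(p^j) - B^(p^j))]. *)
Lemma char_poly_pchar_expr (k : fieldType) p j n (B C : 'M[k]_n.+1) :
  p \in [pchar k] -> B ^+ (p ^ j) = C ^+ (p ^ j) -> char_poly B = char_poly C.
Proof.
move=> chp EBC; have chpX : p \in [pchar {poly k}] by rewrite pchar_poly.
have chpM : p \in [pchar 'M[{poly k}]_n.+1] by apply: rmorph_pchar (@scalar_mx _ _) _ chpX.
apply: (expr_pchar_inj (j := j) chpX) => /=.
have FrobE (D : 'M[k]_n.+1) : char_poly D ^+ (p ^ j)
    = \det ('X%:M ^+ (p ^ j) - map_mx polyC (D ^+ (p ^ j))).
  rewrite rmorphXn -exprBn_comm_pchar //; last exact: comm_scalar_mx.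
  rewrite /char_poly /char_poly_mx.
  by elim: (p ^ j)%N => [|m IHm]; rewrite ?expr0 ?det1 // !exprS det_mulmx IHm.
by rewrite !FrobE EBC.
Qed.

(** If p^j is the order of the p-part of g, then g and its p'-part have the same p^j-th power.
    Dimension 0 is apart because the ring structure needs a positive size. *)
Lemma char_poly_repr_consttC (k : fieldType) p (gT : finGroupType) (G : {group gT})
    n (rG : mx_representation k G n) g :
  p \in [pchar k] -> g \in G -> char_poly (rG (g.`_p^')%g) = char_poly (rG g).
Proof.
case: n rG => [|n] rG chp Gg; first by rewrite /char_poly !det_mx00.
have p_pr := pcharf_prime chp; pose j := logn p #[g]%g.
have Gc (pi : nat_pred) : (g.`_pi)%g \in G by rewrite groupX.
have gp : (g.`_p ^+ (p ^ j)%N = 1)%g by rewrite -p_part -order_constt expg_order.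
apply: (char_poly_pchar_expr (j := j) chp); rewrite -!repr_mxX ?Gc //.
rewrite -[in RHS](consttC p g) expgMn; last first.
  exact: (centsP (cycle_abelian g)) _ (mem_cycle _ _) _ (mem_cycle _ _).
by rewrite gp mul1g.
Qed.

(** * Lattices over a valuation ring *)

Section Lattice.
Variables (K : fieldType) (O : idomainType) (iO : {rmorphism O -> K}).
Hypotheses (iO_inj : injective iO)
           (iO_val : forall x : K, exists a : O, x = iO a \/ x^-1 = iO a).

(** [i0] is a place of least valuation; it exists because divisibility over O is total. The entry
    [i] makes the list non-empty. *)
Lemma valuation_max (I : eqType) (v : I -> K) (i : I) (s : seq I) :
  exists2 i0, i0 \in i :: s & {in i :: s, forall j, exists w, v j = iO w * v i0}.
Proof.
have total x y : (exists w, x = iO w * y) \/ (exists w, y = iO w * x).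
  have [->|x0] := eqVneq x 0; first by left; exists 0; rewrite rmorph0 mul0r.
  have [->|y0] := eqVneq y 0; first by right; exists 0; rewrite rmorph0 mul0r.
  have [a [Ea|Ea]] := iO_val (x / y); [left|right]; exists a; rewrite -Ea.
    by rewrite divfK.
  by rewrite invf_div divfK.
have refl x : exists w, x = iO w * x by exists 1; rewrite rmorph1 mul1r.
elim: s => [|j s [i0 si0 maxi0]].
  by exists i; rewrite ?mem_head // => j; rewrite inE => /eqP->.
have [[w Ew]|[w Ew]] := total (v j) (v i0).
  exists i0; first by move: si0; rewrite !inE => /orP[->|->]; rewrite ?orbT.
  move=> l; rewrite !inE orbCA => /predU1P[->|sl]; first by exists w.
  by apply: maxi0; rewrite inE.
exists j; first by rewrite !inE eqxx orbT.
move=> l; rewrite !inE orbCA => /predU1P[->//|sl].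
have [|u ->] := maxi0 l; first by rewrite inE.
by exists (u * w); rewrite Ew rmorphM mulrA.
Qed.

(* A generating family of minimal size of the O-module spanned by the G-orbit of
   the standard basis is K-free: divide a linear relation by its coefficient of
   least valuation. *)
Lemma lattice_exists (gT : finGroupType) (G : {group gT}) n
    (rG : mx_representation K G n) :
  exists (m : nat) (L : mx_representation O G m), mx_rsim (map_repr iO L) rG.
Proof.
pose stable m (A : 'M[K]_(m, n)) :=
  forall g, g \in G -> exists C : 'M[O]_m, A *m rG g = map_mx iO C *m A.
pose P m := `[< exists A : 'M[K]_(m, n), stable m A /\ row_full A >].
have exP : exists m, P m.
  (* The rows of [A] are the vectors e_j g: they are permuted by G and include the standard
     basis. *)
  pose T : {set gT * 'I_n} := finset.setX G [set: 'I_n].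
  pose A := \matrix_(i < #|T|) row (enum_val i).2 (rG (enum_val i).1).
  have TX x j : x \in G -> (x, j) \in T by move=> Gx; rewrite inE /= Gx inE.
  exists #|T|; apply/asboolP; exists A; split.
    move=> g Gg; exists (\matrix_(i, j)
      (enum_val j == ((enum_val i).1 * g, (enum_val i).2)%g)%:R).
    apply/row_matrixP=> i; rewrite !row_mul rowK [RHS]mulmx_sum_row.
    have := enum_valP i; rewrite inE => /andP[Gi _].
    have Tj := TX _ (enum_val i).2 (groupM Gi Gg).
    rewrite (bigD1 (enum_rank_in Tj ((enum_val i).1 * g, (enum_val i).2)%g)) //=.
    rewrite !mxE enum_rankK_in // eqxx rmorph1 scale1r rowK enum_rankK_in //=.
    rewrite -row_mul -repr_mxM // big1 ?addr0 // => j ne_j.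
    rewrite !mxE; case: eqP => [Ej|_]; last by rewrite rmorph0 scale0r.
    by case/eqP: ne_j; apply: enum_val_inj; rewrite Ej enum_rankK_in.
  rewrite -sub1mx; apply/row_subP=> j.
  have Tj := TX _ j (group1 G); rewrite -(repr_mx1 rG).
  suff -> : row j (rG 1%g) = row (enum_rank_in Tj (1%g, j)) A by apply: row_sub.
  by rewrite rowK enum_rankK_in.
case: (ex_minnP exP) => m /asboolP[A [stA fullA]] minm.
have freeA : row_free A.
  rewrite -kermx_eq0; apply/rowV0P => v /sub_kermxP vA.
  apply/eqP/negPn/negP=> v0.
  case: m A stA fullA minm v vA v0 => [|m] A stA fullA minm v vA v0.
    by case/eqP: v0; rewrite thinmx0.
  have [i0 _ maxi0] := valuation_max (v 0) 0 (enum 'I_m.+1).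
  have {}maxi0 j : exists w, v 0 j = iO w * v 0 i0.
    by apply: maxi0; rewrite inE mem_enum orbT.
  have vi0 : v 0 i0 != 0.
    apply: contraNneq v0 => vi0; apply/eqP/rowP=> j; rewrite mxE.
    by have [w ->] := maxi0 j; rewrite vi0 mulr0.
  have [w wE] := choice maxi0.
  pose A' := row' i0 A.
  (* [D] expresses the rows of [A] in those other than row [i0]: the relation [v], divided by its
     entry at [i0], gives row [i0] the coefficients - w. *)
  pose D : 'M[O]_(m.+1, m) :=
    \matrix_(i, j) if i == i0 then - w (fintype.lift i0 j) else (i == fintype.lift i0 j)%:R.
  have AE : A = map_mx iO D *m A'.
    apply/row_matrixP=> i; rewrite row_mul [RHS]mulmx_sum_row.
    have [->|ne_i] := eqVneq i i0; last first.
      have [|j Ei _] := @unlift_some _ i0 i; first by rewrite eq_sym.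
      have DE l : D i l = (j == l)%:R.
        by rewrite mxE (negPf ne_i) Ei (inj_eq (@lift_inj _ _)).
      rewrite (bigD1 j) //= big1 ?addr0 => [|l ne_l];
        rewrite [row i _ _ _]mxE [map_mx iO D _ _]mxE DE.
        by rewrite eqxx rmorph1 scale1r Ei; apply/rowP=> l; rewrite !mxE.
      by rewrite eq_sym (negPf ne_l) rmorph0 scale0r.
    have /eqP : v 0 i0 *: row i0 A
        + \sum_(j < m) v 0 (fintype.lift i0 j) *: row (fintype.lift i0 j) A = 0.
      by rewrite -[RHS]vA mulmx_sum_row [RHS](bigD1_ord i0).
    rewrite addr_eq0 -sumrN => /eqP E; apply: (scalerI vi0); rewrite E scaler_sumr.
    apply: eq_bigr => j _; rewrite !mxE eqxx (wE (fintype.lift i0 j)).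
    rewrite rmorphN scaleNr scalerN scalerA.
    by rewrite mulrC; congr (- (_ *: _)); apply/rowP=> l; rewrite !mxE.
  have A'E : A' = map_mx iO (row' i0 1%:M) *m A.
    by rewrite map_row' map_mx1 row'Esub mul_rowsub_mx mul1mx -row'Esub.
  suff: P m by move/minm; rewrite ltnn.
  apply/asboolP; exists A'; split=> [g Gg|].
    have [C CE] := stA g Gg; exists (row' i0 1%:M *m C *m D).
    have -> : A' *m rG g = map_mx iO (row' i0 1%:M) *m (A *m rG g).
      by rewrite mulmxA -A'E.
    by rewrite CE !map_mxM -!mulmxA -AE.
  by rewrite -sub1mx; apply: submx_trans (submx_full _ fullA) _; rewrite AE submxMl.
have [C CE] : exists C : gT -> 'M[O]_m,
    forall g, g \in G -> A *m rG g = map_mx iO (C g) *m A.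
  have ex g : exists B : 'M[O]_m, g \in G -> A *m rG g = map_mx iO B *m A.
    have [Gg|nGg] := boolP (g \in G); last by exists 0.
    by have [B EB] := stA g Gg; exists B.
  by have [C CE] := choice ex; exists C.
(* As [A] is row-free and [iO] injective, [C g] is determined by g, whence multiplicativity. *)
have CG : mx_repr G C.
  have map_inj (X Y : 'M[O]_m) : map_mx iO X = map_mx iO Y -> X = Y.
    move=> /matrixP E; apply/matrixP=> i j; apply: iO_inj.
    by have := E i j; rewrite !mxE.
  split=> [|g h Gg Gh]; apply: map_inj; apply: (row_free_inj freeA).
    by rewrite -CE // repr_mx1 mulmx1 map_mx1 mul1mx.
  by rewrite map_mxM -mulmxA -CE ?groupM // -(CE h) // mulmxA -(CE g) // repr_mxM // mulmxA.
exists m, (MxRepresentation CG), A => // [|g Gg]; last by rewrite CE.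
by rewrite -(eqP freeA) (eqP fullA).
Qed.

End Lattice.

(** * The Gelfand-Graev representations *)

(** On the cyclic group of g the character is a multiple of the regular one, so by orthogonality
    each root of unity of order dividing that of g is an eigenvalue equally often. *)
Lemma char_poly_free_cycle (gT : finGroupType) (G : {group gT}) n
    (rG : mx_representation algC G n) g : g \in G ->
  (forall j, ~~ (#[g]%g %| j)%N -> cfRepr rG (g ^+ j)%g = 0) ->
  (#[g]%g %| n)%N /\ char_poly (rG g) = ('X^#[g]%g - 1) ^+ (n %/ #[g]%g).
Proof.
move=> Gg tr0; set m := #[g]%g in tr0 *.
have m_gt0 : (0 < m)%N := order_gt0 g.
have m_neq0 : m%:R != 0 :> algC by rewrite pnatr_eq0 -lt0n.
have [e [[B uB rgE] [em1 _] _ _]] := repr_rsim_diag rG Gg.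
have rgX j : rG (g ^+ j)%g = invmx B *m diag_mx (\row_i e 0 i ^+ j) *m B.
  elim: j => [|j IHj].
    rewrite expg0 repr_mx1; have -> : \row_i e 0 i ^+ 0 = const_mx 1.
      by apply/rowP=> i; rewrite !mxE expr0.
    by rewrite diag_const_mx mulmx1 mulVmx.
  rewrite expgS repr_mxM ?groupX // IHj rgE !mulmxA mulmxK // -!mulmxA; congr (_ *m _).
  rewrite !mulmxA mulmx_diag; congr (diag_mx _ *m _).
  by apply/rowP=> i; rewrite !mxE exprS.
have trX j : \sum_i e 0 i ^+ j = cfRepr rG (g ^+ j)%g.
  rewrite cfunE groupX // mulr1n rgX mxtrace_mulC mulmxA mulmxV // mul1mx mxtrace_diag.
  by apply: eq_bigr => i _; rewrite mxE.
have trace_zero j : (0 < j < m)%N -> \sum_i e 0 i ^+ j = 0.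
  by move=> /andP[j0 jm]; rewrite trX tr0 // gtnNdvd.
have geom (x : algC) : x ^+ m = 1 -> \sum_(j < m) x ^+ j = m%:R * (x == 1)%:R.
  have [->|x1] := eqVneq x 1 => xm.
    by under eq_bigr => j _ do rewrite expr1n; rewrite sumr_const card_ord mulr1.
  have /eqP := subrX1 x m; rewrite xm subrr eq_sym mulf_eq0 subr_eq0 (negPf x1) /=.
  by move/eqP->; rewrite mulr0.
have count_root (z : algC) : z ^+ m = 1 -> (#|[pred i | e 0%R i == z]| * m)%N = n.
  move=> zm; have z0 : z != 0.
    by apply: contra_eq_neq zm => ->; rewrite expr0n gtn_eqF // eq_sym oner_eq0.
  apply/eqP; rewrite -(eqr_nat algC) natrM; apply/eqP.
  (* Summed over j first, each i with eigenvalue z contributes m and the others 0; summed over i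
     first, only j = 0 survives and gives n. *)
  transitivity (\sum_(j < m) z ^- j * \sum_i e 0 i ^+ j).
    under eq_bigr => j _ do rewrite mulr_sumr.
    rewrite exchange_big -sum1_card natr_sum mulr_suml big_mkcond /=.
    apply: eq_bigr => i _; under [RHS]eq_bigr => j _ do rewrite mulrC -expr_div_n.
    rewrite geom; last by rewrite expr_div_n em1 zm divr1.
    rewrite -[_ / _ == 1](inj_eq (mulIf z0)) divfK // mulrC.
    by rewrite mul1r inE; case: eqP; rewrite ?mulr1 ?mulr0.
  rewrite (bigD1 (Ordinal m_gt0)) //= [X in _ + X]big1 ?addr0 => [|j ne_j].
    by rewrite trX expg0 cfRepr1 expr0 invr1 mul1r.
  by rewrite trace_zero ?mulr0 // ltn_ord andbT lt0n.
have m_n : (m %| n)%N by rewrite -(count_root 1) ?expr1n // dvdn_mull.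
split=> //.
have [z prim_z] := C_prim_root_exists m_gt0.
have charE : char_poly (rG g) = \prod_i ('X - (e 0 i)%:P).
  have rfB : row_free B by rewrite row_free_unit.
  rewrite (char_poly_sim (B := diag_mx e) (P := invmx B) erefl)
    ?row_free_unit ?unitmx_inv //.
    rewrite char_poly_trig ?diag_mx_is_trig //.
    by apply: eq_bigr => i _; rewrite mxE eqxx mulr1n.
  by rewrite rgE -!mulmxA mulmxV // mulmx1.
rewrite charE -(factor_Xn_sub_1 prim_z) big_mkord -prodrXl.
have ex i : exists r : 'I_m, e 0 i == z ^+ r.
  by have [r ->] := prim_rootP prim_z (em1 i); exists r.
pose idx i := xchoose (ex i).
rewrite (partition_big idx predT) //=; apply: eq_bigr => r _.
have idxE i : (idx i == r) = (e 0 i == z ^+ r).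
  rewrite (eqP (xchooseP (ex i))) -/(idx i) (eq_prim_root_expr prim_z) !modn_small //.
under eq_bigl => i do rewrite idxE.
under eq_bigr => i /eqP -> do [].
rewrite prodr_const; congr (_ ^+ _).
rewrite -[LHS](mulnK _ m_gt0); congr (_ %/ m)%N; apply: count_root.
by rewrite -exprM mulnC exprM (prim_expr_order prim_z) expr1n.
Qed.

(** * Two-by-two matrices and the orders of U and SL_2(F) *)

Lemma ord2P (i : 'I_2) : i = 0 \/ i = 1.
Proof. by case: i => - [|[|//]] ?; [left|right]; apply: val_inj. Qed.

Lemma det_mx2 (R : comNzRingType) (A : 'M[R]_2) : \det A = A 0 0 * A 1 1 - A 0 1 * A 1 0.
Proof.
rewrite (expand_det_row _ 0) !big_ord_recl big_ord0 addr0 /cofactor !det_mx11 !mxE /=.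
rewrite expr0 mul1r expr1 mulN1r mulrN.
by congr (_ * A _ _ - A _ _ * A _ _); apply: val_inj.
Qed.

Lemma mulmx2E (R : pzSemiRingType) (A B : 'M[R]_2) i j :
  (A *m B) i j = A i 0 * B 0 j + A i 1 * B 1 j.
Proof.
rewrite mxE !big_ord_recl big_ord0 addr0.
by congr (A _ _ * B _ _ + A _ _ * B _ _); apply: val_inj.
Qed.

Section SL2Group.
Variable F : finFieldType.
Local Notation q := #|F|.
Local Notation U := (SL2_unip F).
Local Notation SL := (SL2_group F).

Definition mk_GL2 (A : 'M[F]_2) : {'GL_2[F]} := insubd (1%g : {'GL_2[F]}) A.

Lemma mk_GL2K A : \det A != 0 -> GL2_mx (mk_GL2 A) = A.
Proof.
move=> dA; have uA : A \is a GRing.unit by rewrite -unitfE -unitmxE in dA.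
exact: (insubdK (1%g : {'GL_2[F]}) uA).
Qed.

Lemma GL2_mx_inj : injective (@GL2_mx F).
Proof. exact: val_inj. Qed.

Definition unip_mx (b : F) : 'M[F]_2 := 1%:M + b *: delta_mx 0 1.

Lemma det_unip_mx b : \det (unip_mx b) = 1.
Proof. by rewrite det_mx2 !mxE /=; ring. Qed.

Lemma mul_unip_mx b c : unip_mx b *m unip_mx c = unip_mx (b + c).
Proof.
rewrite /unip_mx mulmxDl mul1mx mulmxDr mulmx1 -scalemxAl -scalemxAr.
by rewrite mul_delta_mx_0 // !scaler0 addr0 scalerDl addrAC -addrA.
Qed.

Lemma unipP g : reflect (exists b, GL2_mx g = unip_mx b) (g \in U).
Proof.
rewrite inE; apply: (iffP and3P) => [[/eqP g0 /eqP g1 /eqP g2]|[b ->]].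
  exists (GL2_mx g 0 1); apply/matrixP=> i j; rewrite !mxE.
  by have [->|->] := ord2P i; have [->|->] := ord2P j;
    rewrite ?g0 ?g1 ?g2 /= ?mulr0 ?mulr1 ?addr0 ?add0r.
by rewrite !mxE /= !mulr0 !addr0 !eqxx.
Qed.

Lemma SL2_unip_sub : U \subset SL.
Proof.
by apply/fintype.subsetP=> g /unipP[b gb]; rewrite inE gb det_unip_mx.
Qed.

Lemma SL2_unip_abelian : abelian U.
Proof.
apply/centsP=> g /unipP[b gb] h /unipP[c hc]; apply: GL2_mx_inj.
by rewrite !GL2_mxM gb hc !mul_unip_mx addrC.
Qed.

Lemma card_SL2_unip : #|U| = q.
Proof.
have mkK b : GL2_mx (mk_GL2 (unip_mx b)) = unip_mx b.
  by rewrite mk_GL2K // det_unip_mx oner_eq0.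
suff -> : U = [set mk_GL2 (unip_mx b) | b in F] :> {set _}.
  rewrite card_imset // => b c /(congr1 (@GL2_mx F)); rewrite !mkK.
  by move/matrixP/(_ 0 1); rewrite !mxE /= !mulr1 !add0r.
apply/setP=> g; apply/unipP/imsetP=> [[b gb]|[b _ ->]].
  by exists b => //; apply: GL2_mx_inj; rewrite mkK.
by exists b; rewrite mkK.
Qed.

(** The determinant maps GL_2(F) onto the units of F, and its fibres are the translates of SL_2(F)
    by diag(c, 1). *)
Lemma card_SL2 : #|SL| = (q * (q ^ 2 - 1))%N.
Proof.
have q_gt1 : (1 < q)%N := finNzRing_gt1 F.
pose D (c : F) : 'M[F]_2 := diag_mx (\row_j if j == 0 then c else 1).
have detD c : \det (D c) = c by rewrite det_diag !big_ord_recl big_ord0 !mxE /= !mulr1.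
have fiber (c : F) : c != 0 -> #|[pred g : {'GL_2[F]} | \det (GL2_mx g) == c]| = #|SL|.
  move=> c0; have DK : GL2_mx (mk_GL2 (D c)) = D c by rewrite mk_GL2K ?detD.
  have detM h : \det (GL2_mx (mk_GL2 (D c) * h)%g) = c * \det (GL2_mx h).
    by rewrite GL2_mxM DK det_mulmx detD.
  rewrite -(card_imset SL (mulgI (mk_GL2 (D c)))); apply: eq_card => g.
  rewrite inE; apply/eqP/imsetP=> [gc|[h]].
    exists ((mk_GL2 (D c))^-1 * g)%g; last by rewrite /= mulKVg.
    by rewrite inE; apply/eqP/(mulfI c0); rewrite -detM mulKVg mulr1.
  by rewrite inE => /eqP h1 ->; rewrite detM h1 mulr1.
have cardGL : #|{: {'GL_2[F]}}| = ((q - 1) * #|SL|)%N.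
  rewrite -[LHS]sum1_card.
  rewrite (partition_big (fun g => \det (GL2_mx g)) (fun c => c != 0)) /=; last first.
    by move=> g _; rewrite -unitfE -unitmxE; apply: (valP g).
  rewrite (eq_bigr (fun=> #|SL|)) => [|c c0].
    rewrite sum_nat_const. congr (_ * _)%N.
    by rewrite subn1 -(cardC1 (0 : F)); apply: eq_card => c; rewrite !inE.
  by rewrite -(fiber c c0) -[RHS]sum1_card.
have cardGL2 : #|{: {'GL_2[F]}}| = (q * ((q - 1) * (q ^ 2 - 1)))%N.
  rewrite -cardsT (@card_GL F 2) //.
  rewrite (_ : 'C(2, 2) = 1%N) // expn1; congr (_ * _)%N.
  by rewrite big_ltn // big_ltn // big_geq // muln1 expn1.
have := cardGL; rewrite cardGL2 mulnCA => /eqP.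
by rewrite eqn_pmul2l ?subn_gt0 // => /eqP.
Qed.

Lemma index_SL2_unip : #|SL : U|%g = (q ^ 2 - 1)%N.
Proof.
have q_gt0 : (0 < q)%N := ltnW (finNzRing_gt1 F).
by rewrite -divgS ?SL2_unip_sub // card_SL2_unip [X in (X %/ _)%N]card_SL2 mulKn.
Qed.

(** A power of g conjugate into U has order dividing both q and the order of g, hence is trivial; so
    the induced character vanishes at the other powers. *)
Lemma char_poly_Gelfand_Graev p e (i : Iirr U) n (rC : mx_representation algC SL n) g :
  prime p -> q = (p ^ e)%N ->
  cfRepr rC = 'Ind[SL, U] 'chi_i -> g \in SL -> coprime p #[g]%g ->
  (#[g]%g %| q ^ 2 - 1)%N /\ char_poly (rC g) = ('X^#[g]%g - 1) ^+ ((q ^ 2 - 1) %/ #[g]%g).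
Proof.
move=> p_pr qE rCE SLg cop.
(* The degree is the index of U, since U is abelian and its character thus linear. *)
have -> : (q ^ 2 - 1)%N = n.
  apply/eqP; rewrite -(eqr_nat algC) -(cfRepr1 rC) rCE cfInd1 ?SL2_unip_sub //.
  have /char_abelianP/(_ i)/lin_char1-> := SL2_unip_abelian.
  by rewrite mulr1 index_SL2_unip.
apply: char_poly_free_cycle => // j ndvd.
rewrite rCE cfIndE ?SL2_unip_sub // big1 ?mulr0 // => y _; apply: cfun0.
apply: contra ndvd => Ugy; rewrite order_dvdn -(conjg_eq1 _ y) -order_eq1.
have : (#[(g ^+ j) ^ y]%g %| p ^ e)%N by rewrite -qE -card_SL2_unip order_dvdG.
have : (#[(g ^+ j) ^ y]%g %| #[g]%g)%N by rewrite orderJ orderXdvd.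
move=> d1 d2; have : (#[(g ^+ j) ^ y]%g %| gcdn (p ^ e) #[g]%g)%N by rewrite dvdn_gcd d2 d1.
by rewrite (eqnP (coprimeXl e cop)) dvdn1.
Qed.

End SL2Group.

(** * The symmetric powers *)

Section RootsOfUnity.
Variables (E : fieldType) (m : nat) (a : E).
Hypothesis prim_a : m.-primitive_root a.

Lemma prod_prim_root_consecutive r l :
  \prod_(r <= i < r + m * l) ('X - (a ^+ i)%:P) = ('X^m - 1) ^+ l.
Proof.
(* Shifting the window by one replaces a^s by a^(s + m) = a^s. *)
have period s : \prod_(s <= i < s + m) ('X - (a ^+ i)%:P) = 'X^m - 1.
  elim: s => [|s IHs]; first by rewrite add0n (factor_Xn_sub_1 prim_a).
  have lt_sm : (s < s + m)%N.
    by rewrite -[X in (X < _)%N]addn0 ltn_add2l (prim_order_gt0 prim_a).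
  rewrite -IHs addSn big_nat_recr // [RHS]big_ltn //=.
  by rewrite mulrC exprD (prim_expr_order prim_a) mulr1.
elim: l => [|l IHl]; first by rewrite muln0 addn0 big_geq.
rewrite mulnS addnCA addnC (@big_cat_nat _ _ _ (r + m * l)) ?leq_addr //=.
by rewrite IHl period exprSr.
Qed.

End RootsOfUnity.

Section Weights.
Variables (E : fieldType) (a b : E).
Hypothesis ab1 : a * b = 1.

(** With b for the inverse of a, the weight i - j needs natural exponents only. *)
Definition weight_factor i j : {poly E} := 'X - (a ^+ i * b ^+ j)%:P.
Definition weight_poly d : {poly E} := \prod_(i < d.+1) weight_factor (d - i) i.

Lemma weight_factorS i j : weight_factor i.+1 j.+1 = weight_factor i j.
Proof. by rewrite /weight_factor !exprS mulrACA ab1 mul1r. Qed.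

Lemma weight_polySS d :
  weight_poly d.+2 = weight_factor d.+2 0 * weight_factor 0 d.+2 * weight_poly d.
Proof.
rewrite /weight_poly big_ord_recl big_ord_recr /= subnn subn0 mulrA mulrAC.
congr (_ * _); apply: eq_bigr => i _.
by rewrite /bump leq0n add1n subSS subSn ?weight_factorS // -ltnS.
Qed.

(** The weights of V_(d+1) and V_d together are the integers from -(d+1) to d+1, that is the
    differences i - j over the pairs with maximum d+1. *)
Lemma weight_poly_pair d : weight_poly d.+1 * weight_poly d =
  \prod_(i < d.+2) weight_factor i d.+1 * \prod_(j < d.+1) weight_factor d.+1 j.
Proof.
elim: d => [|d IHd].
  rewrite /weight_poly !big_ord_recl !big_ord0 /= !mulr1.
  by rewrite /bump /= !subn0 subnn -(weight_factorS 0 0) addn0 -mulrA mulrC.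
rewrite weight_polySS -mulrA [weight_poly d * _]mulrC IHd.
rewrite [X in _ = X * _]big_ord_recl [X in _ = _ * X]big_ord_recl /=.
under [X in _ = _ * X * _]eq_bigr => i _ do rewrite weight_factorS.
under [X in _ = _ * (_ * X)]eq_bigr => i _ do rewrite weight_factorS.
by rewrite [weight_factor d.+2 0 * _]mulrC mulrACA.
Qed.

(** V_n and V_(n-1) add one row and one column to the square of pairs. *)
Lemma prod_weight_poly n :
  \prod_(d < n.+1) weight_poly d * \prod_(d < n) weight_poly d
    = \prod_(j < n.+1) \prod_(i < n.+1) weight_factor i j.
Proof.
elim: n => [|n IHn].
  by rewrite !big_ord_recl !big_ord0 !mulr1 /weight_poly big_ord_recl big_ord0 mulr1.
rewrite big_ord_recr [X in _ * X]big_ord_recr /= mulrACA IHn weight_poly_pair.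
rewrite [RHS]big_ord_recr /=.
under [X in _ = X * _]eq_bigr => j _ do rewrite big_ord_recr /=.
by rewrite big_split /= -mulrA [X in _ = _ * X]mulrC.
Qed.

(** For fixed j the factors run through q consecutive powers of a. If m divides q - 1 these are full
    periods and one factor more; if m divides q + 1 they are one factor short of full periods. *)
Lemma prod_weight_factor_root m q : m.-primitive_root a -> (0 < q)%N ->
  (m %| q - 1)%N || (m %| q + 1)%N ->
  \prod_(j < q) \prod_(i < q) weight_factor i j
    = ('X^m - 1) ^+ ((q ^ 2 - 1) %/ m) * ('X - 1).
Proof.
move=> prim_a q_gt0 m_q; have m_gt0 := prim_order_gt0 prim_a.
have am := prim_expr_order prim_a.
have a0 : a != 0 by apply: contra_eq_neq ab1 => ->; rewrite mul0r eq_sym oner_eq0.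
have bE : b = a ^+ (m - 1).
  apply: (mulfI a0).
  by rewrite ab1 -exprS subn1 prednK.
have prim_b : m.-primitive_root b.
  rewrite bE (prim_root_exp_coprime _ prim_a).
  by rewrite -[m in coprime _ m](prednK m_gt0) subn1 coprimenS.
have factorE i j : weight_factor i j = 'X - (a ^+ (i + (m - 1) * j))%:P.
  by rewrite /weight_factor bE -exprM -exprD.
have q2 : (q ^ 2 - 1 = (q - 1) * (q + 1))%N by rewrite -[in LHS](exp1n 2) subn_sqr.
have row l j : \prod_(i < m * l) weight_factor i j = ('X^m - 1) ^+ l.
  rewrite -(prod_prim_root_consecutive prim_a ((m - 1) * j)).
  rewrite -[X in \prod_(X <= i < _) _]add0n big_addn [X in (X - _)%N]addnC addnK big_mkord.
  by apply: eq_bigr => i _; rewrite factorE.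
have col l : \prod_(j < m * l) ('X - (b ^+ j)%:P) = ('X^m - 1) ^+ l.
  by rewrite -(prod_prim_root_consecutive prim_b 0) add0n big_mkord.
have bm l : b ^+ (m * l) = 1 by rewrite exprM (prim_expr_order prim_b) expr1n.
have aml l : a ^+ (m * l) = 1 by rewrite exprM am expr1n.
have ordE (h : nat -> {poly E}) n1 n2 : n1 = n2 -> \prod_(i < n1) h i = \prod_(i < n2) h i.
  by move->.
case/orP: m_q => /dvdnP[l ql]; rewrite mulnC in ql.
  have -> : ((q ^ 2 - 1) %/ m = l * (q + 1))%N by rewrite q2 ql -mulnA mulKn.
  have qE : q = (m * l).+1 by rewrite -ql subn1 prednK.
  have rowq j : \prod_(i < q) weight_factor i j = ('X^m - 1) ^+ l * ('X - (b ^+ j)%:P).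
    rewrite (ordE (weight_factor^~ j) _ _ qE) big_ord_recr /= row.
    by rewrite /weight_factor aml mul1r.
  under eq_bigr => j _ do rewrite rowq.
  rewrite big_split /= prodr_const card_ord -exprM.
  rewrite (ordE (fun j => 'X - (b ^+ j)%:P) _ _ qE) big_ord_recr /= col bm.
  by rewrite mulrA -exprD -mulnSr addn1.
have -> : ((q ^ 2 - 1) %/ m = l * (q - 1))%N by rewrite q2 ql mulnCA mulKn // mulnC.
have qE : (m * l)%N = q.+1 by rewrite -ql addn1.
(* The missing factor, at i = q, belongs to a^q b^j = b^(j+1). *)
have rowq j : \prod_(i < q) weight_factor i j * ('X - (b ^+ j.+1)%:P) = ('X^m - 1) ^+ l.
  rewrite -(row _ j) (ordE (weight_factor^~ j) _ _ qE) big_ord_recr /= /weight_factor.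
  have -> : a ^+ q = b; last by rewrite exprS.
  by apply: (mulfI a0); rewrite -exprS -qE aml ab1.
have colq : ('X - 1) * \prod_(j < q) ('X - (b ^+ j.+1)%:P) = ('X^m - 1) ^+ l.
  by rewrite -col (ordE (fun j => 'X - (b ^+ j)%:P) _ _ qE) big_ord_recl /= expr0.
have Xm0 : ('X^m - 1 : {poly E}) != 0 by rewrite monic_neq0 ?monicXnsubC.
(* This power is ['X - 1] times the product of all the missing factors, so multiplying by it
   completes every row. *)
apply: (mulIf (x := ('X^m - 1) ^+ l)); first by rewrite expf_neq0.
rewrite -{1}colq mulrCA -big_split /=.
under eq_bigr => j _ do rewrite rowq.
rewrite prodr_const card_ord -exprM [RHS]mulrAC -exprD mulrC; congr (_ ^+ _ * _).
by rewrite -mulnSr -[(q - 1).+1]addn1 subnK.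
Qed.

End Weights.

Lemma coef_affine_expr (R : comNzRingType) (c d : R) i j : (i <= j)%N ->
  ((c%:P + d *: 'X) ^+ i)`_j = if j == i then d ^+ i else 0.
Proof.
elim: i j => [|i IHi] j le_ij; first by rewrite !expr0 coef1; case: eqP.
case: j le_ij => // j le_ij.
rewrite exprS mulrDl coefD coefCM IHi ?leqW // gtn_eqF // mulr0 add0r.
rewrite -scalerAl coefZ coefXM /= IHi // eqSS; case: eqP => _; last by rewrite mulr0.
by rewrite exprS.
Qed.

Lemma sym_mx_map (k E : fieldType) (f : {rmorphism k -> E}) d (A : 'M[k]_2) :
  sym_mx d (map_mx f A) = map_mx f (sym_mx d A).
Proof.
apply/matrixP=> i j; rewrite !mxE -coef_map rmorphM !rmorphXn /row_form !mxE.
by rewrite !rmorphD /= !map_polyC !map_polyZ !map_polyX.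
Qed.

Section SymmetricPowerChar.
Variable E : fieldType.
Implicit Types A P T : 'M[E]_2.

(** For lower triangular A the form [row_form A 0] is constant, so row i of [sym_mx d A] is a
    polynomial of degree at most i. *)
Lemma char_poly_sym_trig d A : A 0 1 = 0 ->
  char_poly (sym_mx d A) = \prod_(i < d.+1) weight_factor (A 0 0) (A 1 1) (d - i) i.
Proof.
move=> A01; have symE (i j : 'I_d.+1) : (i <= j)%N ->
    sym_mx d A i j = if j == i then A 0 0 ^+ (d - i) * A 1 1 ^+ i else 0.
  move=> le_ij; rewrite mxE /row_form A01 scale0r addr0 -polyC_exp coefCM.
  by rewrite coef_affine_expr // -val_eqE /=; case: eqP => // _; rewrite mulr0.
rewrite char_poly_trig; last first.
  by apply/is_trig_mxP=> i j lt_ij; rewrite symE ?(ltnW lt_ij) // -val_eqE gtn_eqF.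
by apply: eq_bigr => i _; rewrite symE // eqxx.
Qed.

Lemma char_poly_sym_conj d A T P : P \in unitmx -> P *m A = T *m P ->
  char_poly (sym_mx d A) = char_poly (sym_mx d T).
Proof.
move=> uP EP; apply/esym; apply: (char_poly_sim (P := sym_mx d P)) => //.
  rewrite row_free_unit; apply: (proj1 (@mulmx1_unit _ _ _ (sym_mx d (invmx P)) _)).
  by rewrite -sym_mxM mulmxV // sym_mx1.
by rewrite -!sym_mxM EP.
Qed.

Lemma eigenvector_trig A a (v : 'rV_2) : v != 0 -> v *m A = a *: v ->
  exists P T, [/\ P \in unitmx, P *m A = T *m P, T 0 0 = a & T 0 1 = 0].
Proof.
move=> v0 vA.
(* A standard basis vector independent of v; with v as first row of [P], the matrix [T] becomes
   lower triangular. *)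
pose w : 'rV[E]_2 := if v 0 0 == 0 then delta_mx 0 0 else delta_mx 0 1.
pose P : 'M[E]_2 := \matrix_(i < 2) if i == 0 then v else w.
have uP : P \in unitmx.
  rewrite unitmxE unitfE det_mx2 !mxE /= /w; case: (eqVneq (v 0 0) 0) => [v00|v00].
    rewrite v00 !mxE /= mul0r sub0r mulr1 oppr_eq0.
    apply: contraNneq v0 => v01; apply/eqP/rowP=> i; rewrite mxE.
    by have [->|->] := ord2P i.
  by rewrite !mxE /= mulr1 mulr0 subr0.
have row0P : row 0 P = v by rewrite rowK.
have /rowP T0 : row 0 (P *m A *m invmx P) = a *: row 0 1%:M.
  by rewrite !row_mul row0P vA -scalemxAl -row0P -row_mul mulmxV.
exists P, (P *m A *m invmx P); split=> //; first by rewrite mulmxKV.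
  by have := T0 0; rewrite [LHS]mxE !mxE /= mulr1.
by have := T0 1; rewrite [LHS]mxE !mxE /= mulr0.
Qed.

End SymmetricPowerChar.

(** If a^j = 1 then T^j is unipotent, so its p-th power is 1; as p is prime to the order of g, that
    order divides j. The trace a + a^-1 comes from F and is fixed by the q-th power map, so a^q is a
    or a^-1. *)
Lemma SL2_triangularisation (F : finFieldType) (E : closedFieldType)
    (f : {rmorphism F -> E}) (p e : nat) (g : {'GL_2[F]}) :
  prime p -> #|F| = (p ^ e)%N -> g \in SL2_group F -> coprime p #[g]%g ->
  exists (P T : 'M[E]_2) (a : E),
    [/\ P \in unitmx, P *m map_mx f (GL2_mx g) = T *m P,
        [/\ T 0 0 = a, T 1 1 = a^-1 & T 0 1 = 0],
        #[g]%g.-primitive_root a &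
        (#[g]%g %| #|F| - 1)%N || (#[g]%g %| #|F| + 1)%N].
Proof.
move=> p_pr qE SLg cop; set A := map_mx f (GL2_mx g).
have chpF : p \in [pchar F] by apply: card_finPcharP qE p_pr.
have chp : p \in [pchar E] by exact: (rmorph_pchar f chpF).
have [a ra] : exists a, root (char_poly A) a.
  by apply/closed_rootP; rewrite size_char_poly.
have /eigenvalueP[v vA v0] : eigenvalue A a by rewrite eigenvalue_root_char.
have [P [T [uP PA T00 T01]]] := eigenvector_trig v0 vA.
exists P, T, a.
have TE : T = P *m A *m invmx P by rewrite PA mulmxK.
have detA : \det A = 1.
  by move: SLg; rewrite inE det_map_mx => /eqP->; rewrite rmorph1.
have detT : \det T = 1.
  by rewrite TE !det_mulmx detA mulr1 -det_mulmx mulmxV // det1.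
have aT : a * T 1 1 = 1 by move: detT; rewrite det_mx2 T00 T01 mul0r subr0.
have a0 : a != 0 by apply: contra_eq_neq aT => ->; rewrite mul0r eq_sym oner_eq0.
have T11 : T 1 1 = a^-1 by apply: (mulfI a0); rewrite aT divff.
have mxX j : map_mx f (GL2_mx (g ^+ j)%g) = A ^+ j.
  elim: j => [|j IHj]; first by rewrite expg0 GL2_mx1 map_mx1.
  by rewrite expgS GL2_mxM map_mxM IHj exprS.
have TX j : P *m A ^+ j = T ^+ j *m P.
  elim: j => [|j IHj]; first by rewrite !expr0 mulmx1 mul1mx.
  by rewrite !exprS -!mulmxE mulmxA PA -!mulmxA IHj.
have TXE j : [/\ (T ^+ j) 0 0 = a ^+ j, (T ^+ j) 0 1 = 0 & (T ^+ j) 1 1 = a ^- j].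
  elim: j => [|j [IH0 IH1 IH2]]; first by rewrite !mxE /= expr0 invr1.
  rewrite !exprSr -!mulmxE !mulmx2E.
  by rewrite IH0 IH1 IH2 T00 T01 T11 !mul0r !mulr0 !addr0 add0r invfM.
have am : a ^+ #[g]%g = 1.
  have [<- _ _] := TXE #[g]%g; rewrite -[T ^+ _](mulmxK uP) -TX -mxX expg_order.
  by rewrite GL2_mx1 map_mx1 mulmx1 mulmxV // mxE.
have min j : a ^+ j = 1 -> (#[g]%g %| j)%N.
  move=> aj; have [] := TXE j; rewrite aj invr1 => N0 N1 N2.
  have Np : T ^+ j ^+ p = 1.
    have chpM : p \in [pchar 'M[E]_2] by apply: rmorph_pchar (@scalar_mx _ _) _ chp.
    (* T^j - 1 has square zero and p is at least 2; the exponent is shaped for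
       [exprBn_comm_pchar]. *)
    have : (T ^+ j - 1) ^+ (p ^ 1) = 0.
      have sq0 : (T ^+ j - 1) ^+ 2 = 0.
        rewrite expr2 -mulmxE; apply/matrixP=> x y; rewrite mulmx2E !mxE.
        by have [->|->] := ord2P x; have [->|->] := ord2P y; rewrite ?N0 ?N1 ?N2 /=; ring.
      by rewrite expn1 -(subnKC (prime_gt1 p_pr)) exprD sq0 mul0r.
    rewrite exprBn_comm_pchar // ?expn1 ?expr1n; last exact: commr1.
    by move/eqP; rewrite subr_eq0 => /eqP.
  have gjp : (g ^+ (j * p) = 1)%g.
    apply: GL2_mx_inj; apply: (map_mx_inj (f := f)); rewrite mxX GL2_mx1 map_mx1.
    have := TX (j * p)%N; rewrite [T ^+ _]exprM Np mul1mx => E1.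
    by rewrite -[LHS]mul1mx -(mulVmx uP) -mulmxA E1 mulVmx.
  by move/eqP: gjp; rewrite -order_dvdn Gauss_dvdl // coprime_sym.
have prim_a : #[g]%g.-primitive_root a.
  have [m prim_m m_dvd] := prim_order_exists (order_gt0 g) am.
  suff -> : #[g]%g = m by [].
  by apply/eqP; rewrite eqn_dvd m_dvd min ?prim_expr_order.
split=> //.
have trT : a + a^-1 = f (\tr (GL2_mx g)).
  rewrite -trace_map_mx -/A; have -> : A = invmx P *m (T *m P) by rewrite -PA mulKmx.
  rewrite mxtrace_mulC -mulmxA mulmxV // mulmx1 /mxtrace !big_ord_recl big_ord0 addr0.
  by rewrite -T11 -T00; congr (T _ _ + T _ _); apply: val_inj.
have Frob : (a + a^-1) ^+ #|F| = a + a^-1 by rewrite trT -rmorphXn /= expf_card.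
have : (a ^+ #|F| - a) * (a ^+ #|F| * a - 1) = 0.
  have FrobD : a ^+ #|F| + a ^- #|F| = a + a^-1.
    rewrite -[RHS]Frob -exprVn exprDn_pchar // qE (eq_pnat _ (pcharf_eq chp)).
    by rewrite pnatX pnat_id.
  have aq0 : a ^+ #|F| != 0 by rewrite expf_neq0.
  move: FrobD aq0; set b := a ^+ _ => FrobD b0.
  transitivity (b * a * ((b + b^-1) - (a + a^-1))); first by field; rewrite a0 b0.
  by rewrite FrobD subrr mulr0.
have q_gt0 : (0 < #|F|)%N := ltnW (finNzRing_gt1 F).
move/eqP; rewrite mulf_eq0 !subr_eq0 => /orP[/eqP aq|/eqP aq]; apply/orP; [left|right].
  by rewrite min //; apply: (mulfI a0); rewrite -exprS subn1 prednK // aq mulr1.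
by rewrite min // addn1 exprSr.
Qed.

(** Both sides come from F, so they may be compared over an algebraic closure of F, where g becomes
    triangular with eigenvalues a and a^-1. *)
Lemma char_poly_sym_SL2 (F : finFieldType) (k : fieldType) (iF : {rmorphism F -> k})
    (p e : nat) (g : {'GL_2[F]}) :
  prime p -> #|F| = (p ^ e)%N -> g \in SL2_group F -> coprime p #[g]%g ->
  (\prod_(1 <= i < #|F|.-1) char_poly (Sym_repr iF i g)) ^+ 2
    * char_poly (Sym_repr iF 0 g) * char_poly (Sym_repr iF #|F|.-1 g)
  = ('X^#[g]%g - 1) ^+ ((#|F| ^ 2 - 1) %/ #[g]%g).
Proof.
move=> p_pr qE SLg cop.
pose S d : {poly F} := char_poly (sym_mx d (GL2_mx g)).
have SymE d : char_poly (Sym_repr iF d g) = map_poly iF (S d).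
  by rewrite map_char_poly -sym_mx_map.
under eq_bigr => i _ do rewrite SymE.
rewrite !SymE -rmorph_prod -rmorphXn -!rmorphM.
transitivity (map_poly iF (('X^#[g]%g - 1) ^+ ((#|F| ^ 2 - 1) %/ #[g]%g))); last first.
  by rewrite rmorphXn rmorphB /= map_polyXn rmorph1.
congr (map_poly iF _).
have [E [f _]] := countable_algebraic_closure F.
apply: (map_poly_inj f).
have [P [T [a [uP PT [T00 T11 T01] prim_a dvd_q]]]] :=
  SL2_triangularisation f p_pr qE SLg cop.
have a0 : a != 0 by rewrite (prim_root_eq0 prim_a) -lt0n order_gt0.
have aa1 : a * a^-1 = 1 by rewrite divff.
have SE d : map_poly f (S d) = weight_poly a a^-1 d.
  rewrite map_char_poly -sym_mx_map (char_poly_sym_conj d uP PT).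
  by rewrite char_poly_sym_trig // T00 T11.
rewrite !rmorphM !rmorphXn rmorph_prod /= rmorphB /= map_polyXn rmorph1.
under eq_bigr => i _ do rewrite SE.
rewrite !SE.
have q_gt1 : (1 < #|F|)%N := finNzRing_gt1 F.
have := prod_weight_factor_root aa1 prim_a (ltnW q_gt1) dvd_q.
(* The square of side q = n + 2 collects V_0, ..., V_(n+1) and V_0, ..., V_n. This is one V_0 too
   many, whose factor ['X - 1] is cancelled at the end. *)
have [n qn] : exists n, #|F| = n.+2 by exists (#|F| - 2)%N; rewrite -addn2 subnK.
move: ('X^_ - 1) ((_ %/ _)%N) => X N; rewrite qn /= -prod_weight_poly //.
have W0 : weight_poly a a^-1 0 = 'X - 1.
  by rewrite /weight_poly big_ord_recl big_ord0 mulr1 /weight_factor !expr0 mulr1.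
have X1 : ('X - 1 : {poly E}) != 0 by rewrite -polyC1 polyXsubC_eq0.
have prodW : \prod_(d < n.+1) weight_poly a a^-1 d
           = weight_poly a a^-1 0 * \prod_(1 <= d < n.+1) weight_poly a a^-1 d.
  by rewrite -(big_mkord xpredT) big_ltn.
move=> H; apply: (mulIf X1); rewrite -H -W0 [\prod_(d < n.+2) _]big_ord_recr /= prodW.
by ring.
Qed.

(** * The decomposition map *)

Section DecompositionMap.
Variables (K : fieldType) (O : idomainType) (k : fieldType).
Variables (iO : {rmorphism O -> K}) (res : {rmorphism O -> k}).
Hypotheses (iO_inj : injective iO)
           (iO_val : forall x : K, exists a : O, x = iO a \/ x^-1 = iO a).

(** Whichever lattices L1 and L2 define the value, the class of M forces their characteristic
    polynomials at p-regular elements to differ by the factor P. Having coefficients in O, this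
    relation descends from K to O and then reduces to k. *)
Lemma decomposition_char_poly p (gT : finGroupType) (G : {group gT}) n
    (M : mx_representation K G n) (s : seq (fgmod k G)) (P : gT -> {poly O}) :
  p \in [pchar k] ->
  {in G, forall g, coprime p #[g]%g -> char_poly (M g) = map_poly iO (P g)} ->
  {in G, forall g, coprime p #[g]%g ->
     \prod_(V <- s) char_poly (tagged V g) = map_poly res (P g)} ->
  decomposition iO res (G0_class M) = \sum_(V <- s) fgclass V.
Proof.
move=> chp cpM cps; have p_pr := pcharf_prime chp.
set D := decomposition _ _ _.
suff: exists (n1 n2 : nat) (L1 : mx_representation O G n1) (L2 : mx_representation O G n2),
    G0_class M = G0_class (map_repr iO L1) - G0_class (map_repr iO L2) /\
    D = G0_class (map_repr res L1) - G0_class (map_repr res L2).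
  case=> n1 [n2 [L1 [L2 [EK ->]]]].
  pose fg (A : fieldType) m (X : mx_representation A G m) := to_fgmod X.
  have cpK := @fgclass_char_poly _ _ _ (fg _ _ M) (fg _ _ (map_repr iO L1))
    (fg _ _ (map_repr iO L2)) EK.
  have cpL g : g \in G -> coprime p #[g]%g -> char_poly (L1 g) = char_poly (L2 g) * P g.
    move=> Gg cop; apply: (map_inj_poly iO_inj (rmorph0 iO)).
    have := cpK (galg_elt K g); rewrite /galg_char_poly !galg_act_elt // => E.
    by rewrite rmorphM /= -cpM // !map_char_poly.
  have Gc g : g \in G -> (g.`_p^')%g \in G by move=> Gg; rewrite groupX.
  have cop_c g : coprime p #[(g.`_p^')%g]%g.
    by rewrite order_constt; apply: pnat_coprime (part_pnat _ _); apply: pnat_id.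
  pose M1 := fg _ _ (map_repr res L1); pose M2 := fg _ _ (map_repr res L2).
  suff /(char_poly_fgclass chp) : {in G, forall g,
      \prod_(V <- [:: M1]) char_poly (tagged V g)
      = \prod_(V <- M2 :: s) char_poly (tagged V g)}.
    rewrite big_seq1 big_cons => E; transitivity (fgclass M1 - fgclass M2) => //.
    by rewrite E addrC addKr.
  move=> g Gg; rewrite big_seq1 big_cons.
  (* Over k, g may be replaced by its p'-part, where the hypotheses apply. *)
  under eq_bigr => V _ do rewrite -(char_poly_repr_consttC _ chp Gg).
  rewrite -!(char_poly_repr_consttC _ chp Gg) cps ?Gc //= -!map_char_poly.
  by rewrite -rmorphM cpL ?Gc.
(* The set is inhabited, so [xget] does not fall back on 0: M has a lattice, and the zero lattice
   serves as L2. *)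
apply: (@xgetPex _ 0 [set y | exists (n1 n2 : nat) (L1 : mx_representation O G n1)
                         (L2 : mx_representation O G n2),
    G0_class M = G0_class (map_repr iO L1) - G0_class (map_repr iO L2) /\
    y = G0_class (map_repr res L1) - G0_class (map_repr res L2)]%classic).
have [m [L LM]] := lattice_exists iO_inj iO_val M.
have L0_repr : mx_repr G (fun _ : gT => 0 : 'M[O]_0).
  by split=> [|x y _ _]; apply/matrixP=> - [].
pose L0 := MxRepresentation L0_repr.
exists (G0_class (map_repr res L) - G0_class (map_repr res L0)), m, 0%N, L, L0; split=> //.
have -> : G0_class (map_repr iO L0) = 0 by apply: (fgclass_dim0 (M := to_fgmod _)).
by rewrite subr0; apply/esym; apply: (@fgclass_rsim _ _ _ (to_fgmod _) (to_fgmod _)) LM.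
Qed.

End DecompositionMap.

(** The two fields are compared only through L; polynomials with integer coefficients pass from one
    to the other. *)
Lemma realises_char_poly (A B L : fieldType) (sigma : {rmorphism A -> L})
    (tau : {rmorphism B -> L}) (gT : finGroupType) (G : {group gT}) n m
    (rA : mx_representation A G n) (rB : mx_representation B G m) g (P : {poly int}) :
  mx_rsim (map_repr sigma rA) (map_repr tau rB) -> g \in G ->
  char_poly (rA g) = map_poly intr P -> char_poly (rB g) = map_poly intr P.
Proof.
move=> [f eq_nm ff fG] Gg cpA; apply: (map_poly_inj tau).
have := char_poly_sim eq_nm ff (fG g Gg); rewrite -!map_char_poly cpA => <-.
by rewrite -!map_poly_comp; apply: eq_map_poly => z /=; rewrite !rmorph_int.
Qed.

Lemma decomposition_Gelfand_Graev (p e : nat) (F : finFieldType)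
    (K : fieldType) (O : idomainType) (k : fieldType)
    (iO : {rmorphism O -> K}) (res : {rmorphism O -> k}) (iF : {rmorphism F -> k})
    (L : fieldType) (sigma : {rmorphism algC -> L}) (tau : {rmorphism K -> L})
    (i : Iirr (SL2_unip F)) (n : nat) (Gam : mx_representation K (SL2_group F) n) :
  prime p -> #|F| = (p ^ e)%N -> injective iO ->
  (forall x : K, exists a : O, x = iO a \/ x^-1 = iO a) ->
  Gelfand_Graev sigma tau i Gam ->
  let V d := G0_class (Sym_repr iF d) in
  decomposition iO res (G0_class Gam) =
    (\sum_(1 <= d < #|F|.-1) V d) *+ 2 + V 0%N + V #|F|.-1.
Proof.
move=> p_pr qE iO_inj iO_val [m [rC [rCE simC]]] V.
have chpk : p \in [pchar k].
  by apply: (rmorph_pchar iF); apply: card_finPcharP qE p_pr.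
pose W d : fgmod k (SL2_group F) := to_fgmod (Sym_repr iF d).
pose s := map W (index_iota 1 #|F|.-1 ++ index_iota 1 #|F|.-1 ++ [:: 0%N; #|F|.-1]).
(* The same polynomial is needed over the integers, algC, K, O and k. *)
pose P (R : nzRingType) (g : {'GL_2[F]}) : {poly R} :=
  ('X^#[g]%g - 1) ^+ ((#|F| ^ 2 - 1) %/ #[g]%g).
have mapP (R S : nzRingType) (f : {rmorphism R -> S}) g : map_poly f (P R g) = P S g.
  by rewrite rmorphXn rmorphB /= map_polyXn rmorph1.
rewrite (decomposition_char_poly (p := p) (s := s) (P := P O) iO_inj iO_val chpk).
- by rewrite /s big_map !big_cat !big_cons big_nil /= !addr0 mulr2n !addrA; exact: erefl.
- move=> g SLg cop; rewrite mapP -(mapP _ _ intr).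
  apply: (realises_char_poly simC SLg); rewrite mapP.
  by have [_ ->] := char_poly_Gelfand_Graev p_pr qE rCE SLg cop.
move=> g SLg cop; rewrite mapP /P -(char_poly_sym_SL2 iF p_pr qE SLg cop).
by rewrite /s big_map !big_cat !big_cons big_nil /= mulr1 expr2 !mulrA.
Qed.

Theorem corollary3p2
  (p e q : nat) (hp : prime p) (he : (0 < e)%N) (hq : q = (p ^ e)%N)
  (F : finFieldType) (hF : #|F| = q)
  (* W = W(F) with residue map rW *)
  (W : idomainType) (rW : {rmorphism W -> F}) (hW : Witt_ring p rW)
  (* K is a finite extension of Frac(W), O its valuation ring *)
  (K : fieldExtType {fraction W}) (O : idomainType)
  (jO : {rmorphism W -> O}) (iO : {rmorphism O -> K})
  (hO : valuation_ring jO iO)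
  (* k is the residue field of K, iF the induced embedding of F = W/pW *)
  (k : fieldType) (res : {rmorphism O -> k}) (hk : residue_field res)
  (iF : {rmorphism F -> k}) (hiF : forall w : W, iF (rW w) = res (jO w))
  (* complex representations and KG-modules are compared over L *)
  (L : fieldType) (sigma : {rmorphism algC -> L}) (tau : {rmorphism K -> L})
  (hK : irreducibles_realisable sigma tau (SL2_group F))
  (i1 i2 : Iirr (SL2_unip F)) (hi : torus_orbit_representatives i1 i2)
  (n1 n2 : nat)
  (Gam1 : mx_representation K (SL2_group F) n1)
  (Gam2 : mx_representation K (SL2_group F) n2)
  (hGam1 : Gelfand_Graev sigma tau i1 Gam1)
  (hGam2 : Gelfand_Graev sigma tau i2 Gam2) :
  let d := @decomposition K O k iO res _ (SL2_group F) in
  let V := fun i : nat => G0_class (Sym_repr iF i) in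
  d (G0_class Gam1) = d (G0_class Gam2) /\
  d (G0_class Gam2) =
    (\sum_(1 <= i < q.-1) V i) *+ 2 + V 0%N + V q.-1.
Proof.
case: hO => iO_inj iO_val _ _ d V; rewrite -hF.
have qE : #|F| = (p ^ e)%N by rewrite hF.
have dGam i n (Gam : mx_representation K (SL2_group F) n) :=
  @decomposition_Gelfand_Graev p e F K O k iO res iF L sigma tau i n Gam
    hp qE iO_inj iO_val.
by rewrite /d (dGam _ _ _ hGam1) (dGam _ _ _ hGam2).
Qed.
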